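(* Let all distributions in $\mathcal M$ be equivalent (pairwise mutually absolutely continuous), let $Q\in\mathcal M$ and $m<\infty$. Let $\mathcal U$ be the set of pairs $u=(u_1,u_2)$ of a.s.-equivalence classes of measurable functions $\mathcal Z\to\mathbb R$ with $\max_{j\in\{1,2\}}\|u_j\|_{L^\infty(Q)}\le m$, viewed as a subset of the ambient Hilbert space $L^2(Q)\oplus L^2(Q)$. Define $\theta:\mathcal M\times\mathcal U\to L^2(Q_X)$ by $\theta(P',u')(x)=\mathrm{cov}_{P'}[u'_1(Z),u'_2(Z)\mid X=x]$. Fix $(P,u)\in\mathcal M\times\mathcal U$, suppose $\mathcal M$ is locally nonparametric at $P$, $\|dQ_X/dP_X\|_{L^\infty(P_X)}<\infty$ and $\|dP/dQ\|_{L^\infty(Q)}<\infty$. Then $\theta$ is totally pathwise differentiable at $(P,u)$ with $\dot\theta_{P,u}^*(w)=(\dot\nu_{P,u}^*(w),\dot\zeta_{P,u}^*(w))$, where $$\dot\nu_{P,u}^*(w)(z)=\frac{dQ_X}{dP_X}(x)\,w(x)\Big[\prod_{j=1}^2\{u_j(z)-E_P[u_j(Z)\mid X=x]\}-\theta(P,u)(x)\Big],$$ $$\dot\zeta_{P,u}^*(w)=\Big(z\mapsto\frac{dP}{dQ}(z)\,\frac{dQ_X}{dP_X}(x)\,w(x)\,\{u_{3-j}(z)-E_P[u_{3-j}(Z)\mid X=x]\}\Big)_{j=1}^2 .$$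
   Context: All Hilbert spaces are real. $\mathcal M$ is a set of probability distributions on a measurable space $\mathcal Z$. $X=\mathscr C(Z)$ for a measurable coarsening $\mathscr C:\mathcal Z\to\mathcal X$; $P_X=P\circ\mathscr C^{-1}$ is the law of $X$ when $Z\sim P$; $x=\mathscr C(z)$ whenever it appears with $z$. For $P\in\mathcal M$ and $s\in L^2(P)$, $\mathscr P(P,\mathcal M,s)$ is the collection of submodels $\{P_\epsilon:\epsilon\in[0,1]\}\subseteq\mathcal M$ with $P_{\epsilon=0}=P$ that are quadratic mean differentiable with score $s$ at $\epsilon=0$, i.e. $\int(\sqrt{dP_\epsilon}-\sqrt{dP}-\tfrac{\epsilon}{2}s\sqrt{dP})^2=o(\epsilon^2)$ as $\epsilon\to0$. The tangent set is $\check{\mathcal M}_P=\{s\in L^2(P):\mathscr P(P,\mathcal M,s)\neq\emptyset\}$ and the tangent space $\dot{\mathcal M}_P$ is the $L^2(P)$-closure of its linear span. $\mathcal M$ is locally nonparametric at $P$ if $\dot{\mathcal M}_P=\{s\in L^2(P):\int s\,dP=0\}$. For a subset $\mathcal U$ of a Hilbert space $\mathcal T$, $u\in\mathcal U$, $t\in\mathcal T$, $\mathscr P(u,\mathcal U,t)$ is the set of paths $\{u_\epsilon:\epsilon\in[0,1]\}\subseteq\mathcal U$ with $\|u_\epsilon-u-\epsilon t\|_{\mathcal T}=o(\epsilon)$; $\check{\mathcal U}_u=\{t\in\mathcal T:\mathscr P(u,\mathcal U,t)\ne\emptyset\}$ and $\dot{\mathcal U}_u$ is the $\mathcal T$-closure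 of its linear span. A map $\theta:\mathcal M\times\mathcal U\to\mathcal W$ ($\mathcal U\subseteq\mathcal T$; $\mathcal T,\mathcal W$ Hilbert) is totally pathwise differentiable at $(P,u)$ if there is a continuous linear $\dot\theta_{P,u}:\dot{\mathcal M}_P\oplus\dot{\mathcal U}_u\to\mathcal W$ such that for all $s\in\check{\mathcal M}_P$, $t\in\check{\mathcal U}_u$, $\{P_\epsilon\}\in\mathscr P(P,\mathcal M,s)$, $\{u_\epsilon\}\in\mathscr P(u,\mathcal U,t)$, $\|\theta(P_\epsilon,u_\epsilon)-\theta(P,u)-\epsilon\,\dot\theta_{P,u}(s,t)\|_{\mathcal W}=o(\epsilon)$. Its Hermitian adjoint is $\dot\theta_{P,u}^*:\mathcal W\to\dot{\mathcal M}_P\oplus\dot{\mathcal U}_u$. Here $\mathcal T=L^2(Q)\oplus L^2(Q)$ and $\mathcal W=L^2(Q_X)$. *)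

(* Defs.v *)
From HB Require Import structures.
From mathcomp Require Import all_boot all_order all_algebra.
From mathcomp Require Import all_classical all_reals all_analysis.

Set Implicit Arguments.
Unset Strict Implicit.
Unset Printing Implicit Defensive.

Import Order.TTheory GRing.Theory Num.Theory.
Import numFieldNormedType.Exports.

Local Open Scope classical_set_scope.
Local Open Scope ring_scope.
Local Open Scope charge_scope.

(** A real Hilbert space is handled through representatives: a real vector space
    with a positive semidefinite inner product, vectors at distance 0 being
    representatives of the same element. Completeness is not recorded, the
    only instances used being the spaces L^2 and their direct sums. *)
Record prehilbert (R : realType) := PreHilbert {
  hsort :> lmodType R ;
  hdot : hsort -> hsort -> R ;
  hdotC : forall x y, hdot x y = hdot y x ;
  hdotDl : forall a x y z, hdot (a *: x + y) z = a * hdot x z + hdot y z ;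
  hdot_ge0 : forall x, 0 <= hdot x x }.

Definition hnorm (R : realType) (H : prehilbert R) (x : H) : R :=
  Num.sqrt (hdot x x).

Section direct_sum.
Context (R : realType) (H1 H2 : prehilbert R).

Definition hsum_dot (x y : H1 * H2) : R := hdot x.1 y.1 + hdot x.2 y.2.

Lemma hsum_dotC x y : hsum_dot x y = hsum_dot y x.
Proof. by rewrite /hsum_dot hdotC [X in _ + X]hdotC. Qed.

Lemma hsum_dotDl a x y z :
  hsum_dot (a *: x + y) z = a * hsum_dot x z + hsum_dot y z.
Proof. by rewrite /hsum_dot /= !hdotDl mulrDr addrACA. Qed.

Lemma hsum_dot_ge0 x : 0 <= hsum_dot x x.
Proof. by rewrite addr_ge0 ?hdot_ge0. Qed.

Definition hsum : prehilbert R :=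
  @PreHilbert R (H1 * H2)%type hsum_dot hsum_dotC hsum_dotDl hsum_dot_ge0.

End direct_sum.

Section L2.
Context (d : measure_display) (T : measurableType d) (R : realType).
Variable mu : {measure set T -> \bar R}.

Let V := LfunType mu (lee1n 2).

Definition L2_dot (f g : V) : R := \int[mu]_x (f x * g x).

Let L2_integrable (f g : V) :
  mu.-integrable setT (EFin \o (fun x => f x * g x)).
Proof.
by have /Lfun1_integrable := Lfun2_mul_Lfun1 (LfunP f) (LfunP g).
Qed.

Lemma L2_dotC f g : L2_dot f g = L2_dot g f.
Proof. by apply: eq_Rintegral => x _; rewrite mulrC. Qed.

Lemma L2_dotDl a f g h : L2_dot (a *: f + g) h = a * L2_dot f h + L2_dot g h.
Proof.
rewrite /L2_dot -RintegralZl// -RintegralD//.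
  by apply: eq_Rintegral => x _; rewrite mulrDl -mulrA.
have := @L2_integrable (a *: f) h.
by apply: eq_integrable => // x _ /=; rewrite -mulrA.
Qed.

Lemma L2_dot_ge0 f : 0 <= L2_dot f f.
Proof. by apply: Rintegral_ge0 => x _; rewrite -expr2 sqr_ge0. Qed.

Definition L2 : prehilbert R := @PreHilbert R V L2_dot L2_dotC L2_dotDl L2_dot_ge0.

End L2.

(** f(e) = o(g(e)) as e decreases to 0, for paths indexed by [0, 1]. *)
Definition littleo0 (R : realType) (f g : R -> R) : Prop :=
  (f : R -> R^o) =o_ (0^'+) (g : R -> R^o).

Section tangent_spaces.
Context (R : realType) (H : prehilbert R).

Definition lin_span (A : set H) : set H :=
  [set x | exists n (a : 'I_n -> R) (v : 'I_n -> H),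
    (forall i, A (v i)) /\ x = \sum_(i < n) a i *: v i].

Definition closed_span (A : set H) : set H :=
  [set x | forall e : R, 0 < e -> exists2 y, lin_span A y & hnorm (x - y) < e].

Definition set_path (U : set H) (u t : H) (u_ : R -> H) : Prop :=
  (forall e, 0 <= e <= 1 -> U (u_ e)) /\
  littleo0 (fun e => hnorm (u_ e - u - e *: t)) (fun e => e).

Definition set_tangent_set (U : set H) (u : H) : set H :=
  [set t | exists u_, set_path U u t u_].

Definition set_tangent_space (U : set H) (u : H) : set H :=
  closed_span (set_tangent_set U u).

End tangent_spaces.

Section density.
Context (d : measure_display) (T : measurableType d) (R : realType).

Definition density (nu : {finite_measure set T -> \bar R})
    (mu : {sigma_finite_measure set T -> \bar R}) (x : T) : R :=
  fine (('d (charge_of_finite_measure nu) '/d mu) x).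

Definition sum_measure (P P' : probability T R) : set T -> \bar R :=
  measure_add P P'.

Section sum_measure_finite.
Variables P P' : probability T R.

HB.instance Definition _ := Measure.on (sum_measure P P').

Let sum_measure_finite : fin_num_fun (sum_measure P P').
Proof.
move=> A mA; rewrite /sum_measure measure_addE fin_numD.
by rewrite !fin_num_measure.
Qed.

HB.instance Definition _ :=
  @Measure_isFinite.Build _ T R (sum_measure P P') sum_measure_finite.

End sum_measure_finite.

(** The integral of (sqrt dP' - sqrt dP - (e/2) s sqrt dP)^2; it does not depend
    on the dominating measure, here P + P'. The integrand is integrable, as s
    is in L^2(P), so that the real-valued integral is the actual one. *)
Definition qmd_remainder (P P' : probability T R) (s : L2 P) (e : R) : R :=
  let mu := sum_measure P P' in
  \int[mu]_z (Num.sqrt (density P' mu z) - Num.sqrt (density P mu z)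
              - e / 2 * s z * Num.sqrt (density P mu z)) ^+ 2.

End density.

Section models.
Context (d : measure_display) (Z : measurableType d) (R : realType).
Implicit Types (M : set (probability Z R)) (P : probability Z R).

Definition model_path M P (s : L2 P) (P_ : R -> probability Z R) : Prop :=
  [/\ forall e, 0 <= e <= 1 -> M (P_ e),
      P_ 0 = P &
      littleo0 (fun e => qmd_remainder (P_ e) s e) (fun e => e ^+ 2)].

Definition model_tangent_set M P : set (L2 P) :=
  [set s | exists P_ : R -> probability Z R, model_path M s P_].
Arguments model_tangent_set : clear implicits.

Definition model_tangent_space M P : set (L2 P) :=
  closed_span (model_tangent_set M P).
Arguments model_tangent_space : clear implicits.

Definition locally_nonparametric M P : Prop :=
  model_tangent_space M P = [set s | \int[P]_z s z = 0].

End models.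
Arguments model_tangent_set {d Z R} M P _.
Arguments model_tangent_space {d Z R} M P _.

Section maps.
Context (R : realType) (H W : prehilbert R).

Definition linear_on (V : set H) (D : H -> W) : Prop :=
  forall a x y, V x -> V y -> hnorm (D (a *: x + y) - (a *: D x + D y)) = 0.

Definition continuous_on (V : set H) (D : H -> W) : Prop :=
  forall x, V x -> forall e : R, 0 < e -> exists2 r : R, 0 < r &
    forall y, V y -> hnorm (y - x) < r -> hnorm (D y - D x) < e.

(** A is the adjoint of D viewed as a map with domain the closed subspace V. *)
Definition hermitian_adjoint (V : set H) (D : H -> W) (A : W -> H) : Prop :=
  forall w, V (A w) /\ forall x, V x -> hdot (D x) w = hdot x (A w).

End maps.

Section total_derivative.
Context (d : measure_display) (Z : measurableType d) (R : realType).
Context (T W : prehilbert R).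
Variables (M : set (probability Z R)) (U : set T).

Definition total_tangent_space (P : probability Z R) (u : T) :
    set (hsum (L2 P) T) :=
  model_tangent_space M P `*` set_tangent_space U u.
Arguments total_tangent_space : clear implicits.

Definition total_pathwise_derivative (theta : probability Z R -> T -> W)
    (P : probability Z R) (u : T) (D : hsum (L2 P) T -> W) : Prop :=
  [/\ linear_on (total_tangent_space P u) D,
      continuous_on (total_tangent_space P u) D &
      forall (s : L2 P) (t : T) P_ u_, model_path M s P_ -> set_path U u t u_ ->
        littleo0
          (fun e => hnorm (theta (P_ e) (u_ e) - theta P u - e *: D (s, t)))
          (fun e => e)].

End total_derivative.
Arguments total_tangent_space {d Z R T} M U P u _.
Arguments total_pathwise_derivative {d Z R T W} M U theta P u D.

Section conditional_covariance.
Context (dZ dX : measure_display) (Z : measurableType dZ)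
  (X : measurableType dX) (R : realType).
Variables (P : probability Z R) (C : {mfun Z >-> X}).

Definition is_cond_expectation (f : Z -> R) (g : X -> R) : Prop :=
  (distribution P C).-integrable setT (EFin \o g) /\
  forall B, measurable B ->
    (\int[distribution P C]_(x in B) (g x)%:E =
     \int[P]_(z in C @^-1` B) (f z)%:E)%E.

(** A version of x |-> E_P[f(Z) | C(Z) = x]. *)
Definition cond_expectation (f : Z -> R) : X -> R :=
  xget (cst 0) [set g | is_cond_expectation f g].

Definition cond_covariance (f g : Z -> R) : X -> R :=
  cond_expectation (fun z => (f z - cond_expectation f (C z)) *
                             (g z - cond_expectation g (C z))).

End conditional_covariance.

(** The element of L^2(mu) represented by f, if there is one. *)
Definition L2_class (d : measure_display) (T : measurableType d) (R : realType)
    (mu : {measure set T -> \bar R}) (f : T -> R) : L2 mu :=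
  xget 0 [set g : L2 mu | (g : T -> R) = f %[ae mu]].

Section theta.
Context (dZ dX : measure_display) (Z : measurableType dZ)
  (X : measurableType dX) (R : realType).
Variables (C : {mfun Z >-> X}) (Q : probability Z R).

Definition bounded_pairs (m : R) : set (hsum (L2 Q) (L2 Q)) :=
  [set u : hsum (L2 Q) (L2 Q) | (Order.max ('N[Q]_+oo [EFin \o u.1]) ('N[Q]_+oo [EFin \o u.2])
            <= m%:E)%E].

Definition theta (P : probability Z R) (u : hsum (L2 Q) (L2 Q)) :
    L2 (distribution Q C) :=
  L2_class (distribution Q C) (cond_covariance P C u.1 u.2).

End theta.
Arguments bounded_pairs {dZ Z R} Q m _.
Arguments theta {dZ dX Z X R} C Q P u.

(* Main.v *)
Require Import Defs.
From HB Require Import structures.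
From mathcomp Require Import all_boot all_order all_algebra.
From mathcomp Require Import all_classical all_reals all_analysis.
From mathcomp Require Import measurable_realfun ess_sup_inf ring lra.

Set Implicit Arguments.
Unset Strict Implicit.
Unset Printing Implicit Defensive.

Import Order.TTheory GRing.Theory Num.Theory.
Import numFieldNormedType.Exports.

Local Open Scope classical_set_scope.
Local Open Scope ring_scope.
Local Open Scope charge_scope.

(** Write [E] for conditional expectation given [C] under [P], [p = dP'/dP] for
    another model [P'], [a = sqrt p - 1], and centre all functions by their [E].
    Bayes' formula [E (p f) = E' f * E p] turns the covariance under [P'] into
    conditional expectations under [P]. Expanding [p = (1 + a)^2] and the
    perturbed functions [u' = u + phi], the increment of the covariance is a term
    linear in [(a, phi)] plus an error which, thanks to the uniform bound on the
    functions, is at most a constant times [beta] when [beta <= 1] and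
    [sqrt beta] otherwise, where [beta = E kappa^2] and [kappa = |a| + |phi|]
    (sums over the two components). So the squared L^2 error is controlled by
    the integral of [beta * min (beta, 1)], that is of [kappa^2 * min (beta, 1)].
    Along a path [kappa <= e S + rho] with [S] a fixed element of [L^2] and [rho]
    of norm [o(e)]; truncating [S^2] at level [K] bounds this integral by
    [2 e^2 (int_(S^2 >= K) S^2 + K * O(e^2)) + o(e^2) = o(e^2)]. The bounds on the
    densities transfer [L^2(P_X)] to [L^2(Q_X)] and [L^2(Q)] to [L^2(P)]. The
    adjoint is computed by pulling functions of [C] out of [E]; its second
    component is a tangent direction because the tangent space of the bounded
    pairs is all of [L^2(Q) + L^2(Q)], unless [m = 0], when that component
    vanishes. *)

(** * Integrable and square integrable functions *)

(** Bayes' formula would naturally be a quotient by [E p], which has no positive lower bound. It is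
    kept in multiplied form, and the factor b = [E p] is removed by writing v = v b - v (b - 1) with
    v bounded. The square root of p is expanded because quadratic mean differentiability controls it
    in L^2. The quadratic part a^2 is then merely integrable, so its conditional expectation need
    not be square integrable; this is why the trivial bound on covariances has to take over where
    beta > 1. The perturbed functions are centred at the unperturbed means, so that they differ from
    the centred unperturbed ones exactly by phi; the shift of the means then enters through a
    product of two shifts, which is of second order. The truncation level K depends on S alone and
    is chosen before e, so that the term carrying K is still o(e^2). Elements of L^2 are functions
    here, and every identity holds almost everywhere for some law; mutual absolute continuity moves
    such identities between P, Q, P' and their images under C. *)

Notation "mu .-Rintegrable f" := (mu.-integrable [set: _] (EFin \o f))
  (at level 2, f at level 9, format "mu .-Rintegrable  f").

Section real_integrals.
Context (d : measure_display) (T : measurableType d) (R : realType).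
Variable mu : {measure set T -> \bar R}.
Implicit Types f g h : T -> R.

Lemma Rintegrable_measurable f : mu.-Rintegrable f -> measurable_fun setT f.
Proof. by move=> /measurable_int /measurable_EFinP. Qed.

Lemma ae_le_integrable f g : measurable_fun setT f -> mu.-Rintegrable g ->
  (\forall x \ae mu, `|f x| <= g x) -> mu.-Rintegrable f.
Proof.
move=> mf ig fg; apply/integrableP; split; first exact/measurable_EFinP.
have /integrableP[_] := ig; apply: le_lt_trans.
apply: ae_ge0_le_integral => //.
- by do 2 apply: measurableT_comp => //; exact/measurable_EFinP.
- apply: measurableT_comp => //; exact: measurable_int ig.
- apply: filterS fg => x fgx _ /=; rewrite lee_fin.
  by rewrite (le_trans fgx)// ler_norm.
Qed.

Lemma ae_eq_integrable f g : measurable_fun setT f -> mu.-Rintegrable g ->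
  (\forall x \ae mu, f x = g x) -> mu.-Rintegrable f.
Proof.
move=> mf ig fg; apply: (ae_le_integrable mf (integrable_norm ig)).
by apply: filterS fg => x ->.
Qed.

Lemma Rintegrable_le f g : measurable_fun setT f -> mu.-Rintegrable g ->
  (forall x, `|f x| <= g x) -> mu.-Rintegrable f.
Proof. by move=> mf ig fg; apply: (ae_le_integrable mf ig); exact: aeW. Qed.

Lemma RintegrableD f g : mu.-Rintegrable f -> mu.-Rintegrable g ->
  mu.-Rintegrable (fun x => f x + g x).
Proof. exact: integrableD. Qed.

Lemma RintegrableB f g : mu.-Rintegrable f -> mu.-Rintegrable g ->
  mu.-Rintegrable (fun x => f x - g x).
Proof. by move=> fi gi; apply: eq_integrable (integrableB _ fi gi). Qed.

Lemma RintegrableZ k f : mu.-Rintegrable f ->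
  mu.-Rintegrable (fun x => k * f x).
Proof. exact: integrableZl. Qed.

Lemma ae_eq_Rintegral f g : measurable_fun setT f -> measurable_fun setT g ->
  (\forall x \ae mu, f x = g x) -> \int[mu]_x f x = \int[mu]_x g x.
Proof.
move=> mf mg fg; rewrite /Rintegral; congr fine.
by apply: ae_eq_integral => //; [exact/measurable_EFinP..|];
  apply: filterS fg => x + _ => ->.
Qed.

Lemma ae_le_Rintegral f g : mu.-Rintegrable f -> mu.-Rintegrable g ->
  (\forall x \ae mu, f x <= g x) -> \int[mu]_x f x <= \int[mu]_x g x.
Proof.
move=> fi gi fg; have [mf mg] := (Rintegrable_measurable fi, Rintegrable_measurable gi).
(* min (f, g) equals f almost everywhere and lies below g everywhere, which replaces the almost sure
   inequality by a pointwise one. *)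
have mi : measurable_fun setT (fun x => Num.min (f x) (g x)).
  exact: measurable_minr.
have -> : \int[mu]_x f x = \int[mu]_x Num.min (f x) (g x).
  by apply: ae_eq_Rintegral => //; apply: filterS fg => x ?; rewrite min_l.
apply: le_Rintegral => //; last by move=> x _; rewrite ge_min lexx orbT.
apply: (ae_eq_integrable mi fi).
by apply: filterS fg => x ?; rewrite min_l.
Qed.

Lemma Rintegrable_ae_bounded f g K : mu.-Rintegrable f ->
  measurable_fun setT g -> (\forall x \ae mu, `|g x| <= K) ->
  mu.-Rintegrable (fun x => f x * g x).
Proof.
move=> fi mg gK; have mf := Rintegrable_measurable fi.
apply: (@ae_le_integrable _ (fun x => K * `|f x|)).
- exact: measurable_funM.
- exact/RintegrableZ/integrable_norm.
- by apply: filterS gK => x gK; rewrite normrM mulrC ler_wpM2r.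
Qed.

Lemma Lfun2P f : f \in Lfun mu 2%:E <->
  measurable_fun setT f /\ mu.-Rintegrable (fun x => f x ^+ 2).
Proof.
split=> [f2|[mf f2]].
  split; last exact: Lfun2_integrable_sqr.
  by move: f2; rewrite inE => /andP[]; rewrite inE.
rewrite inE; apply/andP; split; rewrite inE//= /finite_norm unlock poweR_lty//.
have /integrableP[_] := f2; apply: le_lt_trans.
rewrite le_eqVlt; apply/orP; left; apply/eqP; apply: eq_integral => x _ /=.
by rewrite normrX powR_mulrn.
Qed.

Lemma Lfun2_measurable f : f \in Lfun mu 2%:E -> measurable_fun setT f.
Proof. by move=> /Lfun2P[]. Qed.

Lemma Lfun2_sqr f : f \in Lfun mu 2%:E -> mu.-Rintegrable (fun x => f x ^+ 2).
Proof. by move=> /Lfun2P[]. Qed.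

Lemma Lfun2_mul f g : f \in Lfun mu 2%:E -> g \in Lfun mu 2%:E ->
  mu.-Rintegrable (fun x => f x * g x).
Proof. by move=> f2 g2; have /Lfun1_integrable := Lfun2_mul_Lfun1 f2 g2. Qed.

Lemma Lfun2_ae_le f g : measurable_fun setT f -> g \in Lfun mu 2%:E ->
  (\forall x \ae mu, `|f x| <= `|g x|) -> f \in Lfun mu 2%:E.
Proof.
move=> mf /Lfun2P[mg g2] fg; apply/Lfun2P; split => //.
apply: ae_le_integrable g2 _; first exact: measurable_funX.
apply: filterS fg => x fg; rewrite normrX.
by rewrite -[leRHS]real_normK ?num_real// lerXn2r// nnegrE.
Qed.

Lemma Lfun2D f g : f \in Lfun mu 2%:E -> g \in Lfun mu 2%:E ->
  (fun x => f x + g x) \in Lfun mu 2%:E.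
Proof.
move=> /Lfun2P[mf f2] /Lfun2P[mg g2]; apply/Lfun2P; split.
  exact: measurable_funD.
apply: (@Rintegrable_le _ (fun x => 2 * f x ^+ 2 + 2 * g x ^+ 2)).
- by apply/measurable_funX/measurable_funD.
- by apply: RintegrableD; exact: RintegrableZ.
- move=> x; rewrite ger0_norm ?sqr_ge0// -subr_ge0.
  rewrite (_ : _ - _ = (f x - g x) ^+ 2) ?sqr_ge0//; ring.
Qed.

Lemma Lfun2_ae_bounded f g K : f \in Lfun mu 2%:E ->
  measurable_fun setT g -> (\forall x \ae mu, `|g x| <= K) ->
  (fun x => f x * g x) \in Lfun mu 2%:E.
Proof.
move=> /Lfun2P[mf f2] mg gK; apply/Lfun2P; split; first exact: measurable_funM.
apply: (@eq_integrable _ _ _ mu setT measurableT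
  (EFin \o (fun x => f x ^+ 2 * g x ^+ 2))).
  by move=> x _; rewrite /= exprMn.
apply: (@Rintegrable_ae_bounded _ _ (K ^+ 2) f2); first exact: measurable_funX.
by apply: filterS gK => x gK; rewrite normrX lerXn2r// nnegrE (le_trans _ gK).
Qed.

Lemma Lfun2Z k f : f \in Lfun mu 2%:E -> (fun x => k * f x) \in Lfun mu 2%:E.
Proof.
move=> f2; rewrite (_ : (fun _ => _) = (fun x => f x * k)); last first.
  by apply/funext => x; rewrite mulrC.
by apply: (@Lfun2_ae_bounded f (cst k) `|k|) => //; exact: aeW.
Qed.

Lemma Lfun2B f g : f \in Lfun mu 2%:E -> g \in Lfun mu 2%:E ->
  (fun x => f x - g x) \in Lfun mu 2%:E.
Proof.
move=> f2 g2; rewrite (_ : (fun _ => _) = (fun x => f x + -1 * g x)).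
  exact/Lfun2D/Lfun2Z.
by apply/funext => x; rewrite mulN1r.
Qed.

Lemma Lfun2_norm f : f \in Lfun mu 2%:E -> (fun x => `|f x|) \in Lfun mu 2%:E.
Proof.
move=> f2; apply: (Lfun2_ae_le _ f2).
  by apply: measurableT_comp => //; exact: Lfun2_measurable.
by apply: aeW => x; rewrite normr_id.
Qed.

(** The default 0 of [L2_class] is not taken: f itself, packed as an element of L^2, is a
    witness. *)
Lemma L2_classP f : f \in Lfun mu 2%:E ->
  \forall x \ae mu, (L2_class mu f : T -> R) x = f x.
Proof.
move=> f2; rewrite /L2_class; case: xgetP => [g _ /= gf|].
  by apply: filterS gf => x; exact.
by move=> /(_ (Lfun_Sub (lee1n 2) f2)) []; apply: aeW => x _.
Qed.

End real_integrals.

Section finite_measures.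
Context (d : measure_display) (T : measurableType d) (R : realType).
Variable mu : {finite_measure set T -> \bar R}.
Implicit Types f g h : T -> R.

Lemma Lfun2_cst k : (fun=> k) \in Lfun mu 2%:E.
Proof. exact: (Lfun_cst mu k 2). Qed.

Lemma Lfun2_integrable f : f \in Lfun mu 2%:E -> mu.-Rintegrable f.
Proof.
move=> f2; have := Lfun2_mul f2 (Lfun2_cst 1).
by apply: eq_integrable => // x _; rewrite /= mulr1.
Qed.

Lemma ae_bounded_Lfun2 f K : measurable_fun setT f ->
  (\forall x \ae mu, `|f x| <= K) -> f \in Lfun mu 2%:E.
Proof.
move=> mf fK; have := Lfun2_ae_bounded (Lfun2_cst 1) mf fK.
by rewrite (_ : (fun _ => _) = f)//; apply/funext => x; rewrite mul1r.
Qed.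

Lemma ae_bounded_integrable f K : measurable_fun setT f ->
  (\forall x \ae mu, `|f x| <= K) -> mu.-Rintegrable f.
Proof. by move=> mf fK; exact/Lfun2_integrable/(ae_bounded_Lfun2 mf fK). Qed.

End finite_measures.

(** * Densities and image measures *)

Section density_change.
Context (d : measure_display) (T : measurableType d) (R : realType).
Variables (nu : {finite_measure set T -> \bar R})
          (mu : {sigma_finite_measure set T -> \bar R}).
Hypothesis numu : nu `<< mu.
Implicit Types f g : T -> R.

Lemma EFin_density x :
  (density nu mu x)%:E = ('d (charge_of_finite_measure nu) '/d mu) x.
Proof. by rewrite /density fineK//; exact: Radon_Nikodym_fin_num. Qed.

Lemma integrable_density : mu.-Rintegrable (density nu mu).
Proof.
have := @Radon_Nikodym_integrable _ _ _ (charge_of_finite_measure nu) mu numu.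
by apply: eq_integrable => // x _ /=; rewrite EFin_density.
Qed.

Lemma measurable_density : measurable_fun setT (density nu mu).
Proof. exact: Rintegrable_measurable integrable_density. Qed.

Lemma ae_density_ge0 : \forall x \ae mu, 0 <= density nu mu x.
Proof.
have := @ae_eq_Radon_Nikodym_SigmaFinite _ _ _ nu mu numu setT measurableT.
apply: filterS => x /(_ I) h; rewrite -lee_fin EFin_density -h.
exact: Radon_Nikodym_SigmaFinite.f_ge0.
Qed.

(** The density may be negative on a null set; the absolute value makes the integrand nonnegative
    everywhere. No integrability of f is assumed, so that integrability itself can be transferred in
    both directions. *)
Lemma ge0_integral_density (f : T -> \bar R) : measurable_fun setT f ->
  (forall x, 0 <= f x)%E ->
  (\int[mu]_x (f x * `|density nu mu x|%:E) = \int[nu]_x f x)%E.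
Proof.
move=> mf f0; rewrite -(Radon_Nikodym_SigmaFinite.change_of_variables numu)//.
apply: ae_eq_integral => //.
- apply: emeasurable_funM => //; apply/measurable_EFinP.
  by apply: measurableT_comp => //; exact: measurable_density.
- apply: emeasurable_funM => //.
  exact: measurable_int (Radon_Nikodym_SigmaFinite.f_integrable numu).
- have := @ae_eq_Radon_Nikodym_SigmaFinite _ _ _ nu mu numu setT measurableT.
  move: ae_density_ge0; apply: filterS2 => x dx /(_ I) h _.
  by rewrite ger0_norm// EFin_density -h.
Qed.

Lemma Rintegrable_densityP f : measurable_fun setT f ->
  mu.-Rintegrable (fun x => f x * density nu mu x) <-> nu.-Rintegrable f.
Proof.
move=> mf; have md := measurable_density.
have E : (\int[mu]_x `|(EFin \o (fun x => (f x * density nu mu x)%R)) x| =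
    \int[nu]_x `|(EFin \o f) x|)%E.
  rewrite -ge0_integral_density//.
    by apply: eq_integral => x _ /=; rewrite normrM EFinM.
  by do 2 apply: measurableT_comp => //.
split=> /integrableP[_ h]; apply/integrableP; split.
- exact/measurable_EFinP.
- by rewrite -E.
- exact/measurable_EFinP/measurable_funM.
- by rewrite E.
Qed.

Lemma Rintegral_density f : nu.-Rintegrable f ->
  \int[mu]_x (f x * density nu mu x) = \int[nu]_x f x.
Proof.
move=> fi; rewrite /Rintegral; congr fine.
rewrite -(Radon_Nikodym_change_of_variables numu)//.
by apply: eq_integral => x _; rewrite EFinM EFin_density.
Qed.

Lemma ae_dominates (A : T -> Prop) :
  (\forall x \ae mu, A x) -> \forall x \ae nu, A x.
Proof.
move=> [N [mN N0 AN]]; exists N; split => //.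
by move/null_content_dominatesP : numu; apply.
Qed.

End density_change.

Section bounded_density.
Context (d : measure_display) (T : measurableType d) (R : realType).
Variables (nu : {finite_measure set T -> \bar R})
          (mu : {sigma_finite_measure set T -> \bar R}) (K : R).
Hypotheses (numu : nu `<< mu)
  (dK : \forall x \ae mu, `|density nu mu x| <= K).
Implicit Types f g : T -> R.

Lemma Rintegrable_bounded_density f : mu.-Rintegrable f -> nu.-Rintegrable f.
Proof.
move=> fi; apply/(Rintegrable_densityP numu); first exact: Rintegrable_measurable fi.
exact: (Rintegrable_ae_bounded fi (measurable_density numu) dK).
Qed.

Lemma Lfun2_bounded_density f : f \in Lfun mu 2%:E -> f \in Lfun nu 2%:E.
Proof.
move=> /Lfun2P[mf f2]; apply/Lfun2P; split => //.
exact: Rintegrable_bounded_density.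
Qed.

Lemma le_Rintegral_bounded_density f : mu.-Rintegrable f ->
  (forall x, 0 <= f x) -> \int[nu]_x f x <= K * \int[mu]_x f x.
Proof.
move=> fi f0; have ni := Rintegrable_bounded_density fi.
rewrite -(Rintegral_density numu ni) -RintegralZl//.
apply: ae_le_Rintegral.
- by apply/(Rintegrable_densityP numu) => //; exact: Rintegrable_measurable fi.
- exact: RintegrableZ.
- apply: filterS dK => x dx; rewrite mulrC ler_wpM2r//.
  exact: le_trans (ler_norm _) dx.
Qed.

End bounded_density.

Lemma null_dominates_distribution (dZ dX : measure_display)
  (Z : measurableType dZ) (X : measurableType dX) (R : realType)
  (P Q : probability Z R) (C : {mfun Z >-> X}) :
  P `<< Q -> distribution P C `<< distribution Q C.
Proof.
move=> /null_content_dominatesP PQ; apply/null_content_dominatesP => A mA QA.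
by apply: PQ => //; rewrite -[_ @^-1` _]setTI; exact: measurable_funPT.
Qed.

Section distribution_integral.
Context (dZ dX : measure_display) (Z : measurableType dZ)
  (X : measurableType dX) (R : realType).
Variables (P : probability Z R) (C : {mfun Z >-> X}).
Local Notation PX := (distribution P C).
Implicit Types g : X -> R.

Lemma ae_distribution (A : X -> Prop) :
  (\forall x \ae PX, A x) -> \forall z \ae P, A (C z).
Proof.
move=> [N [mN N0 AN]]; exists (C @^-1` N); split => //.
  by rewrite -[_ @^-1` _]setTI; exact: measurable_funPT.
by move=> z /= Az; exact: AN.
Qed.

Lemma measurable_comp_mfun g : measurable_fun setT g ->
  measurable_fun setT (fun z => g (C z)).
Proof. by move=> mg; apply: measurableT_comp. Qed.

Lemma Rintegrable_distributionP g : measurable_fun setT g ->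
  PX.-Rintegrable g <-> P.-Rintegrable (fun z => g (C z)).
Proof.
move=> mg; have E : (\int[PX]_x `|(EFin \o g) x| =
    \int[P]_z `|(EFin \o (fun z => g (C z))) z|)%E.
  by rewrite ge0_integral_distribution//; do 2 apply: measurableT_comp => //.
split=> /integrableP[_ h]; apply/integrableP; split.
- exact/measurable_EFinP/measurable_comp_mfun.
- by rewrite -E.
- exact/measurable_EFinP.
- by rewrite E.
Qed.

Lemma Rintegral_distribution g : PX.-Rintegrable g ->
  \int[PX]_x g x = \int[P]_z g (C z).
Proof.
move=> gi; have mg := Rintegrable_measurable gi.
rewrite /Rintegral integral_distribution//; first exact/measurable_EFinP.
exact/Rintegrable_distributionP.
Qed.

Lemma Lfun2_distribution g : g \in Lfun PX 2%:E ->
  (fun z => g (C z)) \in Lfun P 2%:E.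
Proof.
move=> /Lfun2P[mg g2]; apply/Lfun2P; split; first exact: measurable_comp_mfun.
by move/Rintegrable_distributionP : g2; apply; exact: measurable_funX.
Qed.

End distribution_integral.

(** * Conditional expectation *)

Section weighted_measure.
Context (d : measure_display) (T : measurableType d) (R : realType).
Variables (mu : {finite_measure set T -> \bar R}) (f : T -> R).
Hypothesis fi : mu.-Rintegrable f.

(** The measure |f| dmu. The proof of integrability is an argument so that the structure of finite
    measure can be attached to [weighted fi]. *)
Definition weighted & mu.-Rintegrable f : set T -> \bar R :=
  fun A => (\int[mu]_(x in A) `|f x|%:E)%E.

Let mf : measurable_fun setT (fun x => `|f x|%:E).
Proof.
apply/measurable_EFinP; apply: measurableT_comp => //.
exact: Rintegrable_measurable fi.
Qed.

Let weighted0 : weighted fi set0 = 0%E.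
Proof. exact: integral_set0. Qed.

Let weighted_ge0 A : (0 <= weighted fi A)%E.
Proof. by apply: integral_ge0 => x _; rewrite lee_fin. Qed.

Let weighted_sigma_additive : semi_sigma_additive (weighted fi).
Proof. by apply: semi_sigma_additive_nng_induced => // x; rewrite lee_fin. Qed.

HB.instance Definition _ := isMeasure.Build _ _ _ (weighted fi)
  weighted0 weighted_ge0 weighted_sigma_additive.

Let weighted_finite : fin_num_fun (weighted fi).
Proof.
move=> A mA; apply: integrable_fin_num => //.
by apply: (integrableS measurableT) => //; exact: integrable_norm fi.
Qed.

HB.instance Definition _ := @Measure_isFinite.Build _ _ _ (weighted fi)
  weighted_finite.

Lemma weighted_dominates : weighted fi `<< mu.
Proof.
apply/null_content_dominatesP => A mA A0; rewrite /weighted.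
by apply: null_set_integral => //; exact: measurable_funTS.
Qed.

(** The Radon-Nikodym derivative of |f| dmu is |f| almost everywhere, because both have the same
    integral over every measurable set. *)
Lemma ge0_integral_weighted (w : T -> \bar R) : measurable_fun setT w ->
  (forall x, 0 <= w x)%E ->
  (\int[weighted fi]_x w x = \int[mu]_x (w x * `|f x|%:E))%E.
Proof.
move=> mw w0; rewrite -(ge0_integral_density weighted_dominates)//.
have md := measurable_density weighted_dominates.
apply: ae_eq_integral => //.
- apply: emeasurable_funM => //; apply/measurable_EFinP.
  exact: measurableT_comp.
- exact: emeasurable_funM.
have := @integral_ae_eq _ _ _ mu setT measurableT 
  ('d (charge_of_finite_measure (weighted fi)) '/d mu) (fun x => `|f x|%:E).
have ffi : mu.-integrable setT (fun x => `|f x|%:E) by exact: integrable_norm fi.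
move=> /(_ ffi) h.
have /h {h} : measurable_fun setT ('d (charge_of_finite_measure (weighted fi)) '/d mu).
  by apply: measurable_int; apply: Radon_Nikodym_integrable; exact: weighted_dominates.
have hh : forall E, E `<=` setT -> measurable E ->
    (\int[mu]_(x in E) `|f x|%:E =
    \int[mu]_(x in E) ('d (charge_of_finite_measure (weighted fi)) '/d mu) x)%E.
  by move=> E _ mE; rewrite -Radon_Nikodym_integral//; exact: weighted_dominates.
move=> /(_ hh); move: (ae_density_ge0 weighted_dominates).
apply: filterS2 => x d0 /(_ I) h _; rewrite ger0_norm//.
by rewrite EFin_density//; [rewrite h|exact: weighted_dominates].
Qed.

End weighted_measure.

(** * Existence, uniqueness, linearity and monotonicity of conditional expectation *)

Section conditional_expectation.
Context (dZ dX : measure_display) (Z : measurableType dZ)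
  (X : measurableType dX) (R : realType).
Variables (P : probability Z R) (C : {mfun Z >-> X}).
Local Notation PX := (distribution P C).
Local Notation E := (cond_expectation P C).
Implicit Types (f : Z -> R) (g w : X -> R).

Let mC (B : set X) : measurable B -> measurable (C @^-1` B).
Proof. by move=> mB; rewrite -[_ @^-1` _]setTI; exact: measurable_funPT. Qed.

Section existence.
Variables (f : Z -> R) (fi : P.-Rintegrable f).

(** The image under C of the signed measure f dP; its derivative with respect to P_X is the
    conditional expectation. As for [weighted], the unnamed argument lets the charge structure be
    attached. *)
Definition ce_charge & P.-Rintegrable f : set X -> \bar R :=
  fun B => (\int[P]_(z in C @^-1` B) (f z)%:E)%E.

Let ce_charge0 : ce_charge fi set0 = 0%E.
Proof. by rewrite /ce_charge preimage_set0 integral_set0. Qed.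

Let ce_charge_fin B : measurable B -> ce_charge fi B \is a fin_num.
Proof.
move=> mB; apply: integrable_fin_num; first exact: mC.
by apply: (integrableS measurableT) => //; exact: mC.
Qed.

Let ce_charge_sigma_additive : semi_sigma_additive (ce_charge fi).
Proof.
(* Sigma-additivity is inherited from the charge f dP, since preimages under C preserve disjoint
   unions. *)
move=> F mF tF mUF; rewrite /ce_charge preimage_bigcup.
have := @charge_semi_sigma_additive _ _ _ (induced_charge fi) (fun n => C @^-1` F n).
apply.
- by move=> n; exact: mC.
- apply/trivIsetP => /= i j _ _ ij; rewrite -preimage_setI.
  by move/trivIsetP : tF => /(_ _ _ _ _ ij) ->//; rewrite preimage_set0.
- by rewrite -preimage_bigcup; exact: mC.
Qed.

HB.instance Definition _ := isCharge.Build _ _ _ (ce_charge fi)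
  ce_charge0 ce_charge_fin ce_charge_sigma_additive.

Lemma ce_charge_dominates : ce_charge fi `<< PX.
Proof.
apply/null_content_dominatesP => B mB B0; rewrite /ce_charge.
apply: null_set_integral; [exact: mC| |exact: B0].
by apply: measurable_funTS; exact: measurable_int fi.
Qed.

Lemma cond_expectation_exists : exists g, is_cond_expectation P C f g.
Proof.
pose h := 'd (ce_charge fi) '/d PX.
have hE : EFin \o (fine \o h) = h.
  apply/funext => x /=; rewrite fineK//.
  exact/Radon_Nikodym_fin_num/ce_charge_dominates.
exists (fine \o h); split; first by rewrite hE; exact/Radon_Nikodym_integrable/ce_charge_dominates.
move=> B mB; transitivity (ce_charge fi B) => //.
rewrite (Radon_Nikodym_integral ce_charge_dominates)//.
by apply: eq_integral => x _; rewrite -/h -[in RHS]hE.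
Qed.

End existence.

Lemma cond_expectationP f : P.-Rintegrable f -> is_cond_expectation P C f (E f).
Proof.
move=> /cond_expectation_exists[g gP]; rewrite /cond_expectation.
by case: xgetP => [h _ //|/(_ g)].
Qed.

Lemma integrable_cond_expectation f : P.-Rintegrable f -> PX.-Rintegrable (E f).
Proof. by move=> /cond_expectationP[]. Qed.

Lemma measurable_cond_expectation f : P.-Rintegrable f ->
  measurable_fun setT (E f).
Proof. by move=> /integrable_cond_expectation/Rintegrable_measurable. Qed.

Lemma is_cond_expectation_unique f g : P.-Rintegrable f ->
  is_cond_expectation P C f g -> \forall x \ae PX, E f x = g x.
Proof.
move=> /cond_expectationP[Ei Eint] [gi gint].
have := @integral_ae_eq _ _ _ PX setT measurableT (EFin \o g) (EFin \o E f) Ei.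
move=> /(_ (measurable_int _ gi)) h.
have /h : forall B, B `<=` setT -> measurable B ->
    (\int[PX]_(x in B) (EFin \o E f) x = \int[PX]_(x in B) (EFin \o g) x)%E.
  by move=> B _ mB; rewrite Eint// gint.
by apply: filterS => x /(_ I) [].
Qed.

Lemma is_cond_expectationD f1 f2 g1 g2 : P.-Rintegrable f1 -> P.-Rintegrable f2 ->
  is_cond_expectation P C f1 g1 -> is_cond_expectation P C f2 g2 ->
  is_cond_expectation P C (fun z => f1 z + f2 z) (fun x => g1 x + g2 x).
Proof.
move=> f1i f2i [g1i g1E] [g2i g2E]; split; first exact: RintegrableD.
move=> B mB; have mCB := mC mB.
under eq_integral do rewrite EFinD.
rewrite integralD//; [|exact: (integrableS measurableT)..].
rewrite g1E// g2E//; under [RHS]eq_integral do rewrite EFinD.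
by rewrite integralD//; exact: (integrableS measurableT).
Qed.

Lemma is_cond_expectationZ k f g : P.-Rintegrable f ->
  is_cond_expectation P C f g ->
  is_cond_expectation P C (fun z => k * f z) (fun x => k * g x).
Proof.
move=> fi [gi gE]; split; first exact: RintegrableZ.
move=> B mB; have mCB := mC mB.
under eq_integral do rewrite EFinM.
rewrite integralZl//; last exact: (integrableS measurableT).
rewrite gE//; under [RHS]eq_integral do rewrite EFinM.
by rewrite integralZl//; exact: (integrableS measurableT).
Qed.

Lemma cond_expectationD f1 f2 : P.-Rintegrable f1 -> P.-Rintegrable f2 ->
  \forall x \ae PX, E (fun z => f1 z + f2 z) x = E f1 x + E f2 x.
Proof.
move=> f1i f2i; apply: is_cond_expectation_unique; first exact: RintegrableD.
exact: is_cond_expectationD (cond_expectationP _) (cond_expectationP _).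
Qed.

Lemma cond_expectationZ k f : P.-Rintegrable f ->
  \forall x \ae PX, E (fun z => k * f z) x = k * E f x.
Proof.
move=> fi; apply: is_cond_expectation_unique; first exact: RintegrableZ.
exact: is_cond_expectationZ (cond_expectationP _).
Qed.

Lemma cond_expectationB f1 f2 : P.-Rintegrable f1 -> P.-Rintegrable f2 ->
  \forall x \ae PX, E (fun z => f1 z - f2 z) x = E f1 x - E f2 x.
Proof.
move=> f1i f2i; have f2i' := RintegrableZ (-1) f2i.
move: (cond_expectationD f1i f2i') (cond_expectationZ (-1) f2i).
apply: filterS2 => x + E2; rewrite E2 mulN1r => <-.
by congr (E _ x); apply/funext => z; rewrite mulN1r.
Qed.

(** On B = {E f < 0} the integral of E f is that of f over the preimage of B, hence nonnegative; so
    the integral of |E f| over B vanishes, E f = 0 almost everywhere on B, and B is null. *)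
Lemma cond_expectation_ge0 f : P.-Rintegrable f ->
  (\forall z \ae P, 0 <= f z) -> \forall x \ae PX, 0 <= E f x.
Proof.
move=> fi f0; have mf := Rintegrable_measurable fi.
have [Ei Eint] := cond_expectationP fi; have mE := Rintegrable_measurable Ei.
pose B := [set x | E f x < 0].
have mB : measurable B.
  have -> : B = E f @^-1` `]-oo, 0[.
    by apply/seteqP; split => x /=; rewrite in_itv.
  by rewrite -[_ @^-1` _]setTI; exact: mE.
have h0 : (\int[PX]_(x in B) (E f x)%:E >= 0)%E.
  rewrite Eint// (@ae_eq_integral _ _ _ P (C @^-1` B) (fun z => `|f z|%:E))//.
  - by apply: integral_ge0 => z _; rewrite lee_fin.
  - exact: mC.
  - by apply: measurable_funTS; exact/measurable_EFinP.
  - by apply: measurable_funTS; apply/measurable_EFinP; exact: measurableT_comp.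
  - by apply: filterS f0 => z ? _; rewrite ger0_norm.
have hB : (\int[PX]_(x in B) `|(E f x)%:E| = 0)%E.
  apply/eqP; rewrite eq_le; apply/andP; split; last exact: integral_ge0.
  rewrite (eq_integral (fun x => - (E f x)%:E)%E); last first.
    by move=> x; rewrite inE /B /= => Ex; rewrite ltr0_norm.
  rewrite integralN; first by rewrite leeNl oppe0.
  apply: integrable_add_def => //; exact: (integrableS measurableT).
have /ae_eq_integral_abs := hB.
have mEB : measurable_fun B (fun x => (E f x)%:E).
  by apply: measurable_funTS; exact/measurable_EFinP.
move=> /(_ mB mEB); apply: filterS => x /= hx; rewrite leNgt; apply/negP => Ex.
by have [Ex0] := hx Ex; rewrite Ex0 ltxx in Ex.
Qed.

Lemma cond_expectation_le f1 f2 : P.-Rintegrable f1 -> P.-Rintegrable f2 ->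
  (\forall z \ae P, f1 z <= f2 z) -> \forall x \ae PX, E f1 x <= E f2 x.
Proof.
move=> f1i f2i f12; have := cond_expectation_ge0 (RintegrableB f2i f1i).
have /[swap]/[apply] : \forall z \ae P, 0 <= f2 z - f1 z.
  by apply: filterS f12 => z; rewrite subr_ge0.
move: (cond_expectationB f2i f1i); apply: filterS2 => x ->.
by rewrite subr_ge0.
Qed.

Lemma cond_expectation_abs_le f1 f2 : P.-Rintegrable f1 -> P.-Rintegrable f2 ->
  (\forall z \ae P, `|f1 z| <= f2 z) -> \forall x \ae PX, `|E f1 x| <= E f2 x.
Proof.
move=> f1i f2i f12; have h1 : \forall x \ae PX, E f1 x <= E f2 x.
  by apply: cond_expectation_le => //; apply: filterS f12 => z; rewrite ler_norml => /andP[].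
have h2 : \forall x \ae PX, E (fun z => -1 * f2 z) x <= E f1 x.
  apply: cond_expectation_le => //; first exact: RintegrableZ.
  by apply: filterS f12 => z; rewrite mulN1r ler_norml => /andP[].
move: h1 h2 (cond_expectationZ (-1) f2i).
apply: filterS3 => x h1 + h; rewrite h mulN1r => h2.
by rewrite ler_norml h1 h2.
Qed.

Lemma cond_expectation_cst k : \forall x \ae PX, E (fun=> k) x = k.
Proof.
apply: is_cond_expectation_unique; first exact: finite_measure_integrable_cst.
split => [|B mB]; first exact: finite_measure_integrable_cst.
transitivity (k%:E * PX B)%E; first exact: integral_cst.
by apply/esym/integral_cst; exact: mC.
Qed.

Lemma cond_expectation_bounded f K : P.-Rintegrable f ->
  (\forall z \ae P, `|f z| <= K) -> \forall x \ae PX, `|E f x| <= K.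
Proof.
move=> fi fK; have Ki : P.-Rintegrable (fun=> K) by exact: finite_measure_integrable_cst.
move: (cond_expectation_abs_le fi Ki fK) (cond_expectation_cst K).
by apply: filterS2 => x /[swap] ->.
Qed.

(** For f >= 0, |E f| dP_X is the image of f dP under C: both agree on measurable sets by the
    defining property. The statement integrates w against this measure, without integrability of w,
    so that [tower] can deduce integrability from it. *)
Lemma ge0_tower f (w : X -> \bar R) : P.-Rintegrable f -> (forall z, 0 <= f z) ->
  measurable_fun setT w -> (forall x, 0 <= w x)%E ->
  (\int[PX]_x (w x * `|E f x|%:E) = \int[P]_z (w (C z) * (f z)%:E))%E.
Proof.
move=> fi f0 mw w0; have [Ei Eint] := cond_expectationP fi.
rewrite -(ge0_integral_weighted Ei)//.
transitivity (\int[pushforward (weighted fi) C]_x w x)%E.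
  apply: eq_measure_integral => B mB _; rewrite /weighted /pushforward.
  transitivity (\int[PX]_(x in B) (E f x)%:E)%E.
    apply: ae_eq_integral => //.
    - by apply: measurable_funTS; apply/measurable_EFinP;
        apply: measurableT_comp => //; exact: Rintegrable_measurable Ei.
    - by apply: measurable_funTS; exact: measurable_int Ei.
    - have := cond_expectation_ge0 fi (aeW _ f0).
      by apply: filterS => x Ex _; rewrite ger0_norm.
  rewrite Eint//; apply: eq_integral => z _; by rewrite ger0_norm.
rewrite ge0_integral_pushforward// ge0_integral_weighted//.
  by apply: eq_integral => z _; rewrite /= ger0_norm.
  exact: measurableT_comp.
by move=> z; exact: w0.
Qed.

End conditional_expectation.

(** * Tower property, pulling out functions of C, Jensen's inequality *)

Section pull_out.
Context (dZ dX : measure_display) (Z : measurableType dZ)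
  (X : measurableType dX) (R : realType).
Variables (P : probability Z R) (C : {mfun Z >-> X}).
Local Notation PX := (distribution P C).
Local Notation E := (cond_expectation P C).
Implicit Types (f : Z -> R) (g w : X -> R).

(** Restricting to B becomes a weight \1_B, so that [tower] with weight \1_B w can verify the
    defining property. *)
Lemma is_cond_expectation_indic f g : P.-Rintegrable f -> PX.-Rintegrable g ->
  (forall B, measurable B ->
    \int[PX]_x (\1_B x * g x) = \int[P]_z (\1_B (C z) * f z)) ->
  is_cond_expectation P C f g.
Proof.
move=> fi gi h; split => // B mB.
have mCB : measurable (C @^-1` B).
  by rewrite -[_ @^-1` _]setTI; exact: measurable_funPT.
have restrictE (d : measure_display) (T : measurableType d)
    (mu : {measure set T -> \bar R}) (A : set T) (k : T -> R) :
    measurable A -> mu.-Rintegrable k ->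
    (\int[mu]_(x in A) (k x)%:E)%E = (\int[mu]_x (\1_A x * k x))%:E.
  move=> mA ki; have mk := Rintegrable_measurable ki.
  rewrite /Rintegral fineK.
    rewrite integral_mkcond; apply: eq_integral => x _.
    by rewrite /patch indicE; case: ifP => _ /=; rewrite ?mul1r ?mul0r.
  apply: integrable_fin_num => //.
  apply: (Rintegrable_le _ (integrable_norm ki)).
    by apply: measurable_funM => //; exact: measurable_indic.
  by move=> x; rewrite normrM indicE /=; case: (_ \in _);
    rewrite ?normr1 ?normr0 ?mul1r ?mul0r.
by rewrite (restrictE _ _ _ _ _ mB gi) (restrictE _ _ _ _ _ mCB fi) h//.
Qed.

(** Signs are removed in three stages: here f and w are nonnegative; next w is the difference of the
    nonnegative |w| + w and |w|; in [tower] f is split in the same way. Integrability of w E f is a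
    conclusion each time. *)
Let tower_ge0 f w : P.-Rintegrable f -> (forall z, 0 <= f z) ->
  measurable_fun setT w -> (forall x, 0 <= w x) ->
  P.-Rintegrable (fun z => w (C z) * f z) ->
  PX.-Rintegrable (fun x => w x * E f x) /\
  \int[PX]_x (w x * E f x) = \int[P]_z (w (C z) * f z).
Proof.
move=> fi f0 mw w0 wfi; have mE := measurable_cond_expectation C fi.
have mwE : measurable_fun setT (fun x => w x * E f x) by exact: measurable_funM.
have E0 := cond_expectation_ge0 C fi (aeW _ f0).
have := ge0_tower C fi f0 (w := EFin \o w).
move=> /(_ ((measurable_EFinP _ _).2 mw)) tower.
have {}tower : (\int[PX]_x `|(w x * E f x)%:E| = \int[P]_z (w (C z) * f z)%:E)%E.
  rewrite -[RHS]tower//.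
  by apply: eq_integral => x _ /=; rewrite normrM (ger0_norm (w0 x)).
split.
  apply/integrableP; split; first exact/measurable_EFinP.
  by rewrite tower; exact: integrable_lty.
rewrite /Rintegral -tower; congr fine; apply: ae_eq_integral => //.
- exact/measurable_EFinP.
- by apply/measurable_EFinP; exact: measurableT_comp.
- by apply: filterS E0 => x Ex _; rewrite /= ger0_norm// mulr_ge0.
Qed.

Let tower_ge0l f w : P.-Rintegrable f -> (forall z, 0 <= f z) ->
  measurable_fun setT w -> P.-Rintegrable (fun z => w (C z) * f z) ->
  PX.-Rintegrable (fun x => w x * E f x) /\
  \int[PX]_x (w x * E f x) = \int[P]_z (w (C z) * f z).
Proof.
move=> fi f0 mw wfi.
have ni : P.-Rintegrable (fun z => `|w (C z)| * f z).
  apply: eq_integrable (integrable_norm wfi) => // z _ /=.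
  by rewrite normrM (ger0_norm (f0 z)).
have mn : measurable_fun setT (fun x => `|w x|) by exact: measurableT_comp.
have [n1 n2] := tower_ge0 fi f0 mn (fun x => normr_ge0 _) ni.
have si : P.-Rintegrable (fun z => (`|w (C z)| + w (C z)) * f z).
  by apply: eq_integrable (RintegrableD ni wfi) => // z _ /=; rewrite mulrDl.
have ms : measurable_fun setT (fun x => `|w x| + w x) by exact: measurable_funD.
have s0 x : 0 <= `|w x| + w x by rewrite -{2}[w x]opprK subr_ge0 -normrN ler_norm.
have [s1 s2] := tower_ge0 fi f0 ms s0 si.
have wE : (fun x => w x * E f x) =
    (fun x => (`|w x| + w x) * E f x - `|w x| * E f x).
  by apply/funext => x; ring.
split; first by rewrite wE; exact: RintegrableB.
rewrite wE RintegralB// n2 s2 -RintegralB//.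
by apply: eq_Rintegral => z _; ring.
Qed.

Lemma tower f w : P.-Rintegrable f ->
  measurable_fun setT w -> P.-Rintegrable (fun z => w (C z) * f z) ->
  PX.-Rintegrable (fun x => w x * E f x) /\
  \int[PX]_x (w x * E f x) = \int[P]_z (w (C z) * f z).
Proof.
move=> fi mw wfi.
have nfi : P.-Rintegrable (fun z => `|f z|) by exact: integrable_norm fi.
have mwC := measurable_comp_mfun C mw.
have ni : P.-Rintegrable (fun z => w (C z) * `|f z|).
  apply: (Rintegrable_le _ (integrable_norm wfi)).
    by apply: measurable_funM => //; exact: Rintegrable_measurable nfi.
  by move=> z; rewrite /= !normrM normr_id.
have [n1 n2] := tower_ge0l nfi (fun z => normr_ge0 _) mw ni.
have sfi : P.-Rintegrable (fun z => `|f z| + f z) by exact: RintegrableD.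
have si : P.-Rintegrable (fun z => w (C z) * (`|f z| + f z)).
  by apply: eq_integrable (RintegrableD ni wfi) => // z _ /=; rewrite mulrDr.
have s0 z : 0 <= `|f z| + f z by rewrite -{2}[f z]opprK subr_ge0 -normrN ler_norm.
have [s1 s2] := tower_ge0l sfi s0 mw si.
have mE := measurable_cond_expectation C fi.
have wE : \forall x \ae PX, w x * E f x =
    w x * E (fun z => `|f z| + f z) x - w x * E (fun z => `|f z|) x.
  by move: (cond_expectationD C nfi fi); apply: filterS => x ->; ring.
split.
  apply: (ae_eq_integrable _ (RintegrableB s1 n1)) => //.
  exact: measurable_funM.
rewrite (ae_eq_Rintegral _ _ wE); last 2 first.
- exact: measurable_funM.
- exact: Rintegrable_measurable (RintegrableB s1 n1).
rewrite RintegralB// n2 s2 -RintegralB//.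
by apply: eq_Rintegral => z _; ring.
Qed.

Lemma Rintegral_cond_expectation f : P.-Rintegrable f ->
  \int[PX]_x E f x = \int[P]_z f z.
Proof.
move=> fi; have [|_] := tower fi (w := cst 1) (measurable_cst _).
  by apply: eq_integrable fi => // z _ /=; rewrite mul1r.
under eq_Rintegral do rewrite mul1r.
by under [RHS]eq_Rintegral do rewrite mul1r.
Qed.

(** By uniqueness it suffices to test against \1_B, and [tower] with weight \1_B w gives the two
    equal integrals. *)
Lemma cond_expectation_pull_out f w : P.-Rintegrable f ->
  measurable_fun setT w -> P.-Rintegrable (fun z => w (C z) * f z) ->
  \forall x \ae PX, E (fun z => w (C z) * f z) x = w x * E f x.
Proof.
move=> fi mw wfi; have [wEi _] := tower fi mw wfi.
apply: is_cond_expectation_unique => //; apply: is_cond_expectation_indic => //.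
move=> B mB.
have mw' : measurable_fun setT (fun x => \1_B x * w x).
  by apply: measurable_funM => //; exact: measurable_indic.
have wfi' : P.-Rintegrable (fun z => \1_B (C z) * w (C z) * f z).
  apply: (Rintegrable_le _ (integrable_norm wfi)).
    apply: measurable_funM; last exact: Rintegrable_measurable fi.
    exact: (measurable_comp_mfun C mw').
  move=> z; rewrite -mulrA normrM indicE /=; case: (_ \in _);
    by rewrite ?normr1 ?normr0 ?mul1r ?mul0r.
have [_ h] := tower fi mw' wfi'.
under eq_Rintegral do rewrite mulrA.
by rewrite h; apply: eq_Rintegral => z _; rewrite mulrA.
Qed.

Lemma cond_expectation_comp w : PX.-Rintegrable w ->
  \forall x \ae PX, E (fun z => w (C z)) x = w x.
Proof.
move=> wi; have mw := Rintegrable_measurable wi.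
have wCi : P.-Rintegrable (fun z => w (C z)) by exact/Rintegrable_distributionP.
apply: is_cond_expectation_unique => //; apply: is_cond_expectation_indic => //.
move=> B mB; apply: (@Rintegral_distribution _ _ _ _ _ _ _ (fun x => \1_B x * w x)).
apply: (Rintegrable_le _ (integrable_norm wi)).
  by apply: measurable_funM => //; exact: measurable_indic.
move=> x; rewrite normrM indicE /=; case: (_ \in _);
  by rewrite ?normr1 ?normr0 ?mul1r ?mul0r.
Qed.

(* Jensen from E[(f - c)^2] >= 0 for countably many c, dense in R. *)
Lemma cond_expectation_sqr f : f \in Lfun P 2%:E ->
  \forall x \ae PX, E f x ^+ 2 <= E (fun z => f z ^+ 2) x.
Proof.
move=> f2; have fi := Lfun2_integrable f2; have f2i := Lfun2_sqr f2.
(* An enumeration of the rationals; numbers that code no rational give 0. *)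
pose c (n : nat) : R := if unpickle n is Some q then ratr q else 0.
have h n : \forall x \ae PX, 2 * c n * E f x - c n ^+ 2 <= E (fun z => f z ^+ 2) x.
  have ki (k : R) : P.-Rintegrable (fun=> k) by exact: finite_measure_integrable_cst.
  have li := RintegrableB (RintegrableZ (2 * c n) fi) (ki (c n ^+ 2)).
  have := cond_expectation_le C li f2i.
  have le2 : \forall z \ae P, 2 * c n * f z - c n ^+ 2 <= f z ^+ 2.
    apply: aeW => z; rewrite -subr_ge0.
    by rewrite (_ : _ - _ = (f z - c n) ^+ 2) ?sqr_ge0//; ring.
  move=> /(_ le2).
  move: (cond_expectationB C (RintegrableZ (2 * c n) fi) (ki (c n ^+ 2))).
  move: (cond_expectationZ C (2 * c n) fi) (cond_expectation_cst P C (c n ^+ 2)).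
  move=> h1 h2 h3 h4.
  have h12 : \forall x \ae PX, E (fun z => 2 * c n * f z) x = 2 * c n * E f x /\
      E (fun=> c n ^+ 2) x = c n ^+ 2 by move: h1 h2; apply: filterS2.
  by move: h12 h3 h4; apply: filterS3 => x [-> ->] ->.
have := ae_foralln h; apply: filterS => x hx.
rewrite leNgt; apply/negP => lt2.
set e := E f x in hx lt2 *; set b := E _ x in hx lt2 *.
pose y := e ^+ 2 - b.
have y0 : 0 < y by rewrite subr_gt0.
(* A rational q between e and e + min (1, y) has (q - e)^2 < y, whereas [hx] at q says y <= (q -
   e)^2. *)
have y1 : 0 < Num.min 1 y by rewrite lt_min ltr01.
have /rat_in_itvoo[q] : e < e + Num.min 1 y by rewrite ltrDl.
rewrite in_itv /= => /andP[eq qe].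
have := hx (pickle q); rewrite /c pickleK.
have yy : Num.min 1 y <= y by rewrite ge_min lexx orbT.
have m1 : Num.min 1 y <= 1 by rewrite ge_min lexx.
rewrite leNgt => /negP; apply; rewrite /y in y0 y1 yy m1 qe.
have lt3 : (ratr q - e) ^+ 2 < e ^+ 2 - b.
  have qe0 : 0 < ratr q - e by rewrite subr_gt0.
  have qe1 : ratr q - e < Num.min 1 (e ^+ 2 - b) by rewrite ltrBlDl.
  rewrite expr2; apply: (lt_le_trans _ yy).
  rewrite -[ltRHS]mul1r; apply: ltr_pM => //; [exact: ltW..|].
  exact: lt_le_trans qe1 m1.
rewrite -subr_gt0 in lt3; rewrite -subr_gt0.
by rewrite (_ : _ - _ = e ^+ 2 - b - (ratr q - e) ^+ 2)//; ring.
Qed.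

Lemma Lfun2_cond_expectation f : f \in Lfun P 2%:E -> E f \in Lfun PX 2%:E.
Proof.
move=> f2; have fi := Lfun2_integrable f2; apply/Lfun2P; split.
  exact: measurable_cond_expectation.
apply: (ae_le_integrable _ (integrable_cond_expectation C (Lfun2_sqr f2))).
  by apply: measurable_funX; exact: measurable_cond_expectation.
move: (cond_expectation_sqr f2); apply: filterS => x.
by rewrite ger0_norm// sqr_ge0.
Qed.

Lemma le_Rintegral_cond_expectation_sqr f : f \in Lfun P 2%:E ->
  \int[PX]_x (E f x ^+ 2) <= \int[P]_z (f z ^+ 2).
Proof.
move=> f2; have f2i := Lfun2_sqr f2; rewrite -(Rintegral_cond_expectation f2i).
apply: ae_le_Rintegral; last exact: cond_expectation_sqr.
- exact/Lfun2_sqr/Lfun2_cond_expectation.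
- exact: integrable_cond_expectation.
Qed.

End pull_out.

(** * Pointwise estimates *)

Section algebra.
Context (R : realType).
Implicit Types A B a b k x y z : R.

Lemma ler_normM_le x y a b : `|x| <= a -> `|y| <= b -> `|x * y| <= a * b.
Proof. by move=> xa yb; rewrite normrM ler_pM. Qed.

Lemma ler_normD_le x y a b : `|x| <= a -> `|y| <= b -> `|x + y| <= a + b.
Proof. by move=> xa yb; rewrite (le_trans (ler_normD _ _))// lerD. Qed.

Lemma ler_normB_le x y a b : `|x| <= a -> `|y| <= b -> `|x - y| <= a + b.
Proof. by move=> xa yb; rewrite (le_trans (ler_normB _ _))// lerD. Qed.

Lemma ler_normB2 x y a : `|x| <= a -> `|y| <= a -> `|x - y| <= 2 * a.
Proof. by move=> xa ya; rewrite mulrDl mul1r ler_normB_le. Qed.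

(** Here a stands for sqrt p - 1, so 2 a is the linear part of p - 1, and c stands for the
    covariance. The constant 9 A^2 is generous: it serves this bound and the next two, and A >= 1
    absorbs lower powers of A. *)
Lemma cov_linear_bound A a g1 g2 phi psi c : 1 <= A ->
  `|g1| <= A -> `|g2| <= A -> `|c| <= A ^+ 2 ->
  `|2 * a * (g1 * g2 - c) + phi * g2 + psi * g1| <=
  9 * A ^+ 2 * (`|a| + `|phi| + `|psi|).
Proof.
move=> A1 g1A g2A cA.
have N : `|g1 * g2 - c| <= 2 * A ^+ 2.
  have := ler_normB (g1 * g2) c; have := ler_normM_le g1A g2A; lra.
have h1 : `|2 * a * (g1 * g2 - c)| <= 2 * `|a| * (2 * A ^+ 2).
  by apply: ler_normM_le => //; rewrite normrM ger0_norm.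
have h2 := ler_normM_le (lexx `|phi|) g2A.
have h3 := ler_normM_le (lexx `|psi|) g1A.
have := ler_normD (2 * a * (g1 * g2 - c) + phi * g2) (psi * g1).
have := ler_normD (2 * a * (g1 * g2 - c)) (phi * g2).
have := normr_ge0 a; have := normr_ge0 phi; have := normr_ge0 psi.
move: `|a| `|phi| `|psi| h1 h2 h3 => x y w h1 h2 h3 w0 y0 x0.
have AA : A <= A ^+ 2 by rewrite expr2; nra.
nra.
Qed.

Lemma cov_quadratic_bound A a g1 g2 phi psi c : 1 <= A ->
  `|g1| <= A -> `|g2| <= A -> `|g1 + phi| <= A -> `|g2 + psi| <= A ->
  `|c| <= A ^+ 2 ->
  `|(1 + a) ^+ 2 * ((g1 + phi) * (g2 + psi) - c) -
    ((g1 * g2 - c) + (2 * a * (g1 * g2 - c) + phi * g2 + psi * g1))| <=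
  9 * A ^+ 2 * (`|a| + `|phi| + `|psi|) ^+ 2.
Proof.
move=> A1 g1A g2A FA HA cA.
(* phi is the difference of g1 + phi and g1, both bounded by A; this reduces the cubic term a psi
   phi to second order. *)
have phiA : `|phi| <= 2 * A.
  have := ler_normB (g1 + phi) g1; rewrite addrAC subrr add0r; lra.
have N : `|(g1 + phi) * (g2 + psi) - c| <= 2 * A ^+ 2.
  have := ler_normB ((g1 + phi) * (g2 + psi)) c; have := ler_normM_le FA HA; lra.
(* Each term has two small factors. The perturbed product multiplying a^2 is left unexpanded, being
   bounded as a whole by [N]. *)
rewrite (_ : _ - _ = phi * psi + 2 * (a * phi) * g2 + 2 * (a * psi) * g1 +
  2 * (a * psi) * phi + a ^+ 2 * ((g1 + phi) * (g2 + psi) - c)); last by ring.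
set t1 := phi * psi; set t2 := 2 * (a * phi) * g2; set t3 := 2 * (a * psi) * g1.
set t4 := 2 * (a * psi) * phi; set t5 := a ^+ 2 * _.
have h1 : `|t1| <= `|phi| * `|psi| by rewrite normrM.
have h2 : `|t2| <= 2 * (`|a| * `|phi|) * A.
  by apply: ler_normM_le => //; rewrite !normrM ger0_norm.
have h3 : `|t3| <= 2 * (`|a| * `|psi|) * A.
  by apply: ler_normM_le => //; rewrite !normrM ger0_norm.
have h4 : `|t4| <= 2 * (`|a| * `|psi|) * (2 * A).
  by apply: ler_normM_le => //; rewrite !normrM ger0_norm.
have h5 : `|t5| <= `|a| ^+ 2 * (2 * A ^+ 2).
  by apply: ler_normM_le => //; rewrite normrX.
have := ler_normD (t1 + t2 + t3 + t4) t5.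
have := ler_normD (t1 + t2 + t3) t4.
have := ler_normD (t1 + t2) t3; have := ler_normD t1 t2.
have := normr_ge0 a; have := normr_ge0 phi; have := normr_ge0 psi.
move: `|a| `|phi| `|psi| h1 h2 h3 h4 h5 phiA => x y w h1 h2 h3 h4 h5 yA w0 y0 x0.
move: `|t1| `|t2| `|t3| `|t4| `|t5| h1 h2 h3 h4 h5 => u1 u2 u3 u4 u5 h1 h2 h3 h4 h5.
have AA : A <= A ^+ 2 by rewrite expr2; nra.
have A1' : 1 <= A ^+ 2 by exact: le_trans AA.
move=> k1 k2 k3 k4.
have xy0 : 0 <= x * y by exact: mulr_ge0.
have xw0 : 0 <= x * w by exact: mulr_ge0.
have yw0 : 0 <= y * w by exact: mulr_ge0.
have e1 : x * y * A <= x * y * A ^+ 2 by rewrite ler_wpM2l.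
have e2 : x * w * A <= x * w * A ^+ 2 by rewrite ler_wpM2l.
have e3 : y * w <= y * w * A ^+ 2 by rewrite ler_peMr.
have e4 : 0 <= y ^+ 2 * A ^+ 2 by rewrite mulr_ge0// sqr_ge0.
have e5 : 0 <= w ^+ 2 * A ^+ 2 by rewrite mulr_ge0// sqr_ge0.
have e6 : 0 <= x ^+ 2 * A ^+ 2 by rewrite mulr_ge0// sqr_ge0.
have e7 : 0 <= x * y * A ^+ 2 by rewrite mulr_ge0// sqr_ge0.
have e8 : 0 <= x * w * A ^+ 2 by rewrite mulr_ge0// sqr_ge0.
have e9 : 0 <= y * w * A ^+ 2 by rewrite mulr_ge0// sqr_ge0.
rewrite (_ : 9 * A ^+ 2 * (x + y + w) ^+ 2 = 9 * (x ^+ 2 * A ^+ 2) +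
 9 * (y ^+ 2 * A ^+ 2) + 9 * (w ^+ 2 * A ^+ 2) + 18 * (x * y * A ^+ 2) +
 18 * (x * w * A ^+ 2) + 18 * (y * w * A ^+ 2)); last by ring.
lra.
Qed.

(** First order is enough for the conditional means, since their shifts enter the covariance as a
    product of two. *)
Lemma mean_quadratic_bound A a g phi : 1 <= A ->
  `|g + phi| <= A ->
  `|(1 + a) ^+ 2 * (g + phi) - g| <=
  9 * A ^+ 2 * (`|a| + `|phi|) + 9 * A ^+ 2 * (`|a| + `|phi|) ^+ 2.
Proof.
move=> A1 FA.
rewrite (_ : _ - _ = phi + 2 * a * (g + phi) + a ^+ 2 * (g + phi)); last by ring.
set t2 := 2 * a * _; set t3 := a ^+ 2 * _.
have h2 : `|t2| <= 2 * `|a| * A.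
  by apply: ler_normM_le => //; rewrite !normrM ger0_norm.
have h3 : `|t3| <= `|a| ^+ 2 * A.
  by apply: ler_normM_le => //; rewrite normrX.
have := ler_normD (phi + t2) t3; have := ler_normD phi t2.
have := normr_ge0 a; have := normr_ge0 phi.
move: `|a| `|phi| h2 h3 => x y h2 h3 y0 x0 k1 k2.
have AA : A <= A ^+ 2 by rewrite expr2; nra.
have A1' : 1 <= A ^+ 2 by exact: le_trans AA.
have e1 : x * A <= x * A ^+ 2 by rewrite ler_wpM2l.
have e2 : x ^+ 2 * A <= x ^+ 2 * A ^+ 2 by rewrite ler_wpM2l// sqr_ge0.
have e3 : y <= y * A ^+ 2 by rewrite ler_peMr.
have e4 : 0 <= x * y * A ^+ 2 by rewrite mulr_ge0 ?sqr_ge0 ?mulr_ge0.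
have e5 : 0 <= y ^+ 2 * A ^+ 2 by rewrite mulr_ge0// sqr_ge0.
have e6 : 0 <= x ^+ 2 * A ^+ 2 by rewrite mulr_ge0// sqr_ge0.
have e7 : 0 <= x * A ^+ 2 by rewrite mulr_ge0// sqr_ge0.
have e8 : 0 <= y * A ^+ 2 by rewrite mulr_ge0// sqr_ge0.
rewrite (_ : 9 * A ^+ 2 * (x + y) + 9 * A ^+ 2 * (x + y) ^+ 2 =
 9 * (x * A ^+ 2) + 9 * (y * A ^+ 2) + 9 * (x ^+ 2 * A ^+ 2) +
 9 * (y ^+ 2 * A ^+ 2) + 18 * (x * y * A ^+ 2)); last by ring.
lra.
Qed.

(* For beta <= 1 every term is O(beta); otherwise the crude bounds on
   y, z1, z2 and |L| <= B * sqrt beta suffice. *)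
Lemma cov_remainder_bound B y z1 z2 b L alpha beta : 1 <= B ->
  0 <= alpha -> alpha ^+ 2 <= beta ->
  `|y * b - L| <= B * beta -> `|L| <= B * alpha ->
  `|b - 1| <= 2 * alpha + beta ->
  `|z1 * b| <= B * alpha + B * beta -> `|z2 * b| <= B * alpha + B * beta ->
  `|y| <= B -> `|z1| <= B -> `|z2| <= B ->
  (y - z1 * z2 - L) ^+ 2 <= (41 * B ^+ 2) ^+ 2 * (beta * Num.min beta 1).
Proof.
move=> B1 a0 ab hy hL hb hz1 hz2 yB z1B z2B.
have B0 : 0 <= B by exact: le_trans B1.
have b0 : 0 <= beta by apply: le_trans ab; exact: sqr_ge0.
pose s := Num.sqrt beta.
have s0 : 0 <= s by exact: sqrtr_ge0.
have ss : s ^+ 2 = beta by rewrite sqr_sqrtr.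
have als : alpha <= s by rewrite -(ler_pXn2r (n := 2))// ?nnegrE// ss.
have BB : B <= B ^+ 2 by rewrite expr2 ler_peMr.
have BB1 : 1 <= B ^+ 2 by exact: le_trans BB.
have Bs : B * alpha <= B * s by rewrite ler_wpM2l.
have [b1|b1] := leP beta 1.
- have s1 : s <= 1 by rewrite -(ler_pXn2r (n := 2))// ?nnegrE// ss expr1n.
  have bs : beta <= s by rewrite -ss expr2 ler_piMl.
  have Bbs : B * beta <= B * s by rewrite ler_wpM2l.
  have hb3 : `|b - 1| <= 3 * s by lra.
  (* The factor b is removed without division: v = v b - v (b - 1), and the crude bound |v| <= B
     controls the second term. *)
  have bound v : `|v| <= B -> `|v * b| <= 2 * B * s -> `|v| <= 5 * B * s.
    move=> vB vb; have h := ler_normM_le vB hb3.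
    have := ler_normB (v * b) (v * (b - 1)).
    rewrite (_ : v * b - v * (b - 1) = v); [lra|ring].
  have y5 : `|y| <= 5 * B * s.
    apply: bound => //; have := ler_normD (y * b - L) L.
    rewrite subrK; lra.
  have z15 : `|z1| <= 5 * B * s by apply: bound => //; lra.
  have z25 : `|z2| <= 5 * B * s by apply: bound => //; lra.
  have zz := ler_normM_le z15 z25.
  have yb := ler_normM_le y5 hb3.
  (* 41 = 1 + 15 + 25, from y b - L, y (b - 1) and z1 z2 respectively. *)
  have e : `|y - z1 * z2 - L| <= 41 * B ^+ 2 * beta.
    have := ler_normB (y * b - L - y * (b - 1)) (z1 * z2).
    have := ler_normB (y * b - L) (y * (b - 1)).
    rewrite (_ : y * b - L - y * (b - 1) - z1 * z2 = y - z1 * z2 - L); last by ring.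
    move: yb zz; have -> : 5 * B * s * (3 * s) = 15 * (B * beta) by rewrite -ss; ring.
    have -> : 5 * B * s * (5 * B * s) = 25 * (B ^+ 2 * beta) by rewrite -ss; ring.
    have : B * beta <= B ^+ 2 * beta by rewrite ler_wpM2r.
    rewrite -(mulrA 41); lra.
  rewrite -real_normK ?num_real// -expr2 -exprMn lerXn2r// nnegrE ?normr_ge0//.
  by rewrite mulr_ge0// mulr_ge0// sqr_ge0.
- have s1 : 1 <= s by rewrite -(ler_pXn2r (n := 2))// ?nnegrE// ss expr1n ltW.
  have zz := ler_normM_le z1B z2B.
  (* The crude bounds give B + B^2 + B s <= 3 B^2 s; the larger constant matches the other case.
     Squaring s yields beta, which is beta min (beta, 1) here. *)
  have e : `|y - z1 * z2 - L| <= 41 * B ^+ 2 * s.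
    have := ler_normB (y - z1 * z2) L; have := ler_normB y (z1 * z2).
    have : B * s <= B ^+ 2 * s by rewrite ler_wpM2r.
    have : B ^+ 2 <= B ^+ 2 * s by rewrite ler_peMr// sqr_ge0.
    rewrite -expr2 in zz; rewrite -(mulrA 41); lra.
  rewrite -real_normK ?num_real// mulr1 -ss -exprMn lerXn2r// nnegrE ?normr_ge0//.
  by rewrite mulr_ge0// mulr_ge0// sqr_ge0.
Qed.

End algebra.

(** * Bayes' formula and quadratic mean differentiability *)

Section bayes.
Context (dZ dX : measure_display) (Z : measurableType dZ)
  (X : measurableType dX) (R : realType).
Variables (P P' : probability Z R) (C : {mfun Z >-> X}).
Hypothesis P'P : P' `<< P.
Local Notation PX := (distribution P C).
Local Notation p := (density P' P).
Local Notation E := (cond_expectation P C).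

Lemma Rintegrable_mul_density f : P'.-Rintegrable f ->
  P.-Rintegrable (fun z => p z * f z).
Proof.
move=> fi; have mf := Rintegrable_measurable fi.
have := (Rintegrable_densityP P'P mf).2 fi.
by apply: eq_integrable => // z _ /=; rewrite mulrC.
Qed.

Lemma Rintegral_mul_density f : P'.-Rintegrable f ->
  \int[P]_z (p z * f z) = \int[P']_z f z.
Proof.
move=> fi; rewrite -(Rintegral_density P'P fi).
by apply: eq_Rintegral => z _; rewrite mulrC.
Qed.

(** Tested against \1_B, both sides give the integral of \1_B(C) f under P': the density p turns
    integrals under P into integrals under P', where E' f may replace f. The product form avoids
    dividing by E p. *)
Lemma cond_expectation_bayes f : P'.-Rintegrable f ->
  \forall x \ae PX, E (fun z => p z * f z) x = cond_expectation P' C f x * E p x.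
Proof.
move=> fi; have pfi := Rintegrable_mul_density fi.
have pI : P.-Rintegrable p := integrable_density P'P.
pose G := cond_expectation P' C f.
have Gi : (distribution P' C).-Rintegrable G := integrable_cond_expectation C fi.
have mG := Rintegrable_measurable Gi.
have indM (d : measure_display) (T : measurableType d) (mu : {measure set T -> \bar R})
    (k : T -> R) (B : T -> R) : measurable_fun setT B -> (forall t, `|B t| <= 1) ->
    mu.-Rintegrable k -> mu.-Rintegrable (fun t => B t * k t).
  move=> mB B1 ki; have := Rintegrable_ae_bounded ki mB (aeW _ B1).
  by apply: eq_integrable => // t _ /=; rewrite mulrC.
have ind1 B (x : X) : `|\1_B x : R| <= 1.
  by rewrite indicE; case: (_ \in _); rewrite ?normr1 ?normr0.
have Gpi : P.-Rintegrable (fun z => G (C z) * p z).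
  apply/(Rintegrable_densityP P'P); first exact: measurable_comp_mfun.
  exact/Rintegrable_distributionP.
have [GEi _] := tower pI mG Gpi.
apply: is_cond_expectation_unique => //; apply: is_cond_expectation_indic => //.
move=> B mB; have mI : measurable_fun setT (\1_B : X -> R) by exact: measurable_indic.
have mIC := measurable_comp_mfun C mI.
transitivity (\int[P]_z (\1_B (C z) * G (C z) * p z)).
  have mIG : measurable_fun setT (fun x => \1_B x * G x) by exact: measurable_funM.
  have IGpi : P.-Rintegrable (fun z => \1_B (C z) * G (C z) * p z).
    have := indM _ _ _ _ _ mIC (fun z => ind1 B (C z)) Gpi.
    by apply: eq_integrable => // z _ /=; rewrite mulrA.
  have [_ h] := tower pI mIG IGpi.
  by rewrite -h; apply: eq_Rintegral => x _; rewrite mulrA.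
have IGi := indM _ _ _ _ _ mI (ind1 B) Gi.
have IGCi : P'.-Rintegrable (fun z => \1_B (C z) * G (C z)).
  apply/(@Rintegrable_distributionP _ _ _ _ _ P' C (fun x => \1_B x * G x)) => //.
  exact: measurable_funM.
rewrite (Rintegral_density P'P IGCi) -(Rintegral_distribution IGi).
have Ifi := indM _ _ _ _ _ mIC (fun z => ind1 B (C z)) fi.
have [_ ->] := tower fi mI Ifi.
rewrite -(Rintegral_mul_density Ifi); apply: eq_Rintegral => z _; ring.
Qed.

End bayes.

(** * Quadratic mean remainder with P as dominating measure *)

Lemma measurable_sqrt (d : measure_display) (T : measurableType d) (R : realType)
  (f : T -> R) : measurable_fun setT f ->
  measurable_fun setT (fun z => Num.sqrt (f z)).
Proof.
move=> mf; apply: measurableT_comp => //.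
by apply: continuous_measurable_fun; exact: sqrt_continuous.
Qed.

(** As P' is dominated by P, the chain rule gives dP'/dmu = dP/dmu * dP'/dP for mu = P + P'; the
    factor sqrt (dP/dmu) comes out of the square and turns dmu into dP. *)
Lemma qmd_remainderE (d : measure_display) (Z : measurableType d) (R : realType)
    (P P' : probability Z R) (s : L2 P) (e : R) : P' `<< P ->
  P.-Rintegrable (fun z => (Num.sqrt (density P' P z) - 1 - e / 2 * s z) ^+ 2) ->
  qmd_remainder P' s e =
  \int[P]_z (Num.sqrt (density P' P z) - 1 - e / 2 * s z) ^+ 2.
Proof.
move=> P'P ki; rewrite /qmd_remainder; set mu := sum_measure P P'.
have Pmu : P `<< mu.
  apply/null_content_dominatesP => A mA muA.
  have : measure_add P P' A = 0%E by exact: muA.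
  by rewrite measure_addE => /eqP; rewrite padde_eq0// => /andP[/eqP].
have P'mu : P' `<< mu := null_dominates_trans P'P Pmu.
rewrite -(Rintegral_density Pmu ki).
have mp := measurable_density P'P; have mP := measurable_density Pmu.
have mP' := measurable_density P'mu.
have ms : measurable_fun setT (s : Z -> R) by exact: measurable_funPT.
apply: ae_eq_Rintegral.
- apply: measurable_funX; apply: measurable_funB.
    by apply: measurable_funB; exact: measurable_sqrt.
  by apply: measurable_funM; [exact: measurable_funM|exact: measurable_sqrt].
- apply: measurable_funM => //; apply: measurable_funX; apply: measurable_funB.
    by apply: measurable_funB => //; exact: measurable_sqrt.
  exact: measurable_funM.
move: (Radon_Nikodym_chain_rule (nu := charge_of_finite_measure P') P'P Pmu).
move: (ae_density_ge0 Pmu); apply: filterS2 => z P0 /(_ I) h.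
have -> : density P' mu z = density P mu z * density P' P z.
  rewrite mulrC /density h fineM//; exact: Radon_Nikodym_fin_num.
rewrite sqrtrM// -[in RHS](sqr_sqrtr P0); ring.
Qed.

(** * Expansion of the conditional covariance *)

Section centering.
Context (dZ dX : measure_display) (Z : measurableType dZ)
  (X : measurableType dX) (R : realType).
Variables (P : probability Z R) (C : {mfun Z >-> X}).
Local Notation PX := (distribution P C).
Local Notation E := (cond_expectation P C).
Implicit Types (f h : Z -> R).

Definition centered f z := f z - E f (C z).

Lemma measurable_centered f : P.-Rintegrable f -> measurable_fun setT (centered f).
Proof.
move=> fi; apply: measurable_funB; first exact: Rintegrable_measurable fi.
exact/measurable_comp_mfun/measurable_cond_expectation.
Qed.

Lemma centered_bounded f m : P.-Rintegrable f ->
  (\forall z \ae P, `|f z| <= m) -> \forall z \ae P, `|centered f z| <= 2 * m.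
Proof.
move=> fi fm; move: fm (ae_distribution (cond_expectation_bounded C fi fm)).
apply: filterS2 => z fz Ez; have := ler_normB (f z) (E f (C z)).
rewrite /centered; lra.
Qed.

Lemma centered_mul_bounded f h m : P.-Rintegrable f -> P.-Rintegrable h ->
  (\forall z \ae P, `|f z| <= m) -> (\forall z \ae P, `|h z| <= m) ->
  \forall z \ae P, `|centered f z * centered h z| <= (2 * m) ^+ 2.
Proof.
move=> fi hi fm hm; move: (centered_bounded fi fm) (centered_bounded hi hm).
by apply: filterS2 => z f2 h2; rewrite expr2; exact: ler_normM_le.
Qed.

Lemma centered_mul_integrable f h m : P.-Rintegrable f -> P.-Rintegrable h ->
  (\forall z \ae P, `|f z| <= m) -> (\forall z \ae P, `|h z| <= m) ->
  P.-Rintegrable (fun z => centered f z * centered h z).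
Proof.
move=> fi hi fm hm; apply: ae_bounded_integrable (centered_mul_bounded fi hi fm hm).
by apply: measurable_funM; exact: measurable_centered.
Qed.

Lemma cond_covariance_bounded f h m : P.-Rintegrable f -> P.-Rintegrable h ->
  (\forall z \ae P, `|f z| <= m) -> (\forall z \ae P, `|h z| <= m) ->
  \forall x \ae PX, `|cond_covariance P C f h x| <= (2 * m) ^+ 2.
Proof.
move=> fi hi fm hm; apply: cond_expectation_bounded.
- exact: centered_mul_integrable fm hm.
- exact: centered_mul_bounded fi hi fm hm.
Qed.

Lemma cond_expectation_centered f : P.-Rintegrable f ->
  \forall x \ae PX, E (centered f) x = 0.
Proof.
move=> fi; have Ei := integrable_cond_expectation C fi.
have ECi : P.-Rintegrable (fun z => E f (C z)).
  by apply/Rintegrable_distributionP => //; exact: Rintegrable_measurable Ei.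
move: (cond_expectationB C fi ECi) (cond_expectation_comp Ei).
by apply: filterS2 => x -> ->; rewrite subrr.
Qed.

(** The factor of the score in the derivative; its conditional mean given C is 0, by
    [cond_expectation_cov_residual]. *)
Definition cov_residual f h z :=
  centered f z * centered h z - cond_covariance P C f h (C z).

End centering.

(** * Pointwise expansion for one perturbed law and pair of functions *)

Section covariance_expansion.
Context (dZ dX : measure_display) (Z : measurableType dZ)
  (X : measurableType dX) (R : realType).
Variables (P P' : probability Z R) (C : {mfun Z >-> X}).
Hypotheses (P'P : P' `<< P) (PP' : P `<< P').
Variables (f h f' h' : Z -> R) (m : R).
Hypotheses (m1 : 1 <= m) (mf : measurable_fun setT f) (mh : measurable_fun setT h)
  (mf' : measurable_fun setT f') (mh' : measurable_fun setT h')
  (fm : \forall z \ae P, `|f z| <= m) (hm : \forall z \ae P, `|h z| <= m)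
  (f'm : \forall z \ae P, `|f' z| <= m) (h'm : \forall z \ae P, `|h' z| <= m).
Local Notation PX := (distribution P C).
Local Notation p := (density P' P).
Local Notation E := (cond_expectation P C).
Local Notation E' := (cond_expectation P' C).
Local Notation cov := (cond_covariance P C f h).
Local Notation cov' := (cond_covariance P' C f' h').
Let a z := Num.sqrt (p z) - 1.
Let phi z := f' z - f z.
Let psi z := h' z - h z.
Let g1 := centered P C f.
Let g2 := centered P C h.
(** Centred at the unperturbed mean E f, so that F = g1 + phi exactly; likewise H = g2 + psi. *)
Let F z := f' z - E f (C z).
Let H z := h' z - E h (C z).
Let N := cov_residual P C f h.

Definition expansion_size z := `|a z| + `|phi z| + `|psi z|.
Local Notation kappa := expansion_size.

(** The first-order part of p (F H - cov) - N, with 2 a in place of p - 1 = 2 a + a^2. *)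
Definition cov_linear z := 2 * a z * N z + phi z * g2 z + psi z * g1 z.
Local Notation ell := cov_linear.

Let A := 2 * m.
Let B := 9 * A ^+ 2.

Let A1 : 1 <= A.
Proof. by rewrite /A; have := m1; move: (m) => t; lra. Qed.

Let B1 : 1 <= B.
Proof.
by have : 1 <= A ^+ 2 := exprn_ege1 2 A1; rewrite /B; move: (A ^+ 2) => t; lra.
Qed.

Let fi : P.-Rintegrable f.  Proof. exact: ae_bounded_integrable fm. Qed.
Let hi : P.-Rintegrable h.  Proof. exact: ae_bounded_integrable hm. Qed.
Let f'i' : P'.-Rintegrable f'.
Proof. exact: ae_bounded_integrable (ae_dominates P'P f'm). Qed.
Let h'i' : P'.-Rintegrable h'.
Proof. exact: ae_bounded_integrable (ae_dominates P'P h'm). Qed.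

(** Bounds on versions of E' hold almost everywhere for the image of P'; this domination carries
    them to P_X. *)
Let PXP' : distribution P C `<< distribution P' C.
Proof. exact: null_dominates_distribution. Qed.

Let z1 x := E' f' x - E f x.
Let z2 x := E' h' x - E h x.
(** Since E' (F H) = cov' + z1 z2, this is the change of the covariance when the means are kept at
    their unperturbed values; cov' - cov = y - z1 z2. *)
Let y x := cov' x + z1 x * z2 x - cov x.

Let mE k : P.-Rintegrable k -> measurable_fun setT (E k).
Proof. exact: measurable_cond_expectation. Qed.

Let mE' k : P'.-Rintegrable k -> measurable_fun setT (E' k).
Proof. exact: measurable_cond_expectation. Qed.

Let mz1 : measurable_fun setT z1.
Proof. by apply: measurable_funB; [exact: mE'|exact: mE]. Qed.

Let mz2 : measurable_fun setT z2.
Proof. by apply: measurable_funB; [exact: mE'|exact: mE]. Qed.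

Let mcov : measurable_fun setT cov.
Proof. exact/mE/(centered_mul_integrable C fi hi fm hm). Qed.

Let mcov' : measurable_fun setT cov'.
Proof.
apply/mE'/(centered_mul_integrable C f'i' h'i' (ae_dominates P'P f'm)).
exact: (ae_dominates P'P h'm).
Qed.

Let z1A : \forall x \ae PX, `|z1 x| <= A.
Proof.
have := ae_dominates PXP' (cond_expectation_bounded C f'i' (ae_dominates P'P f'm)).
move: (cond_expectation_bounded C fi fm); apply: filterS2 => x h1 h2.
exact: ler_normB2.
Qed.

Let z2A : \forall x \ae PX, `|z2 x| <= A.
Proof.
have := ae_dominates PXP' (cond_expectation_bounded C h'i' (ae_dominates P'P h'm)).
move: (cond_expectation_bounded C hi hm); apply: filterS2 => x h1 h2.
exact: ler_normB2.
Qed.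

Let covA : \forall x \ae PX, `|cov x| <= A ^+ 2.
Proof. exact: cond_covariance_bounded. Qed.

Let cov'A : \forall x \ae PX, `|cov' x| <= A ^+ 2.
Proof.
apply: (ae_dominates PXP'); apply: cond_covariance_bounded => //;
  exact: (ae_dominates P'P).
Qed.

Let yB : \forall x \ae PX, `|y x| <= B.
Proof.
have h0 : \forall x \ae PX, `|z1 x * z2 x| <= A * A.
  by move: z1A z2A; apply: filterS2 => x; exact: ler_normM_le.
move: covA cov'A h0; apply: filterS3 => x h1 h2 h3.
apply: le_trans (ler_normB_le (ler_normD_le h2 h3) h1) _.
by rewrite /B -expr2; have := sqr_ge0 A; move: (A ^+ 2) => t; lra.
Qed.

Let mp : measurable_fun setT p.
Proof. exact: measurable_density. Qed.

Let ma : measurable_fun setT a.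
Proof. by apply: measurable_funB => //; exact: measurable_sqrt. Qed.

Let mphi : measurable_fun setT phi. Proof. exact: measurable_funB. Qed.
Let mpsi : measurable_fun setT psi. Proof. exact: measurable_funB. Qed.

Let pI : P.-Rintegrable p.
Proof. exact: integrable_density. Qed.

Let p_sqr : \forall z \ae P, p z = (1 + a z) ^+ 2.
Proof.
move: (ae_density_ge0 P'P); apply: filterS => z p0.
by rewrite /a addrC subrK sqr_sqrtr.
Qed.

Lemma Lfun2_sqrt_density : (fun z => Num.sqrt (p z)) \in Lfun P 2%:E.
Proof.
apply/Lfun2P; split; first exact: measurable_sqrt.
apply: (ae_eq_integrable _ pI).
  by apply: measurable_funX; exact: measurable_sqrt.
by move: (ae_density_ge0 P'P); apply: filterS => z; exact: sqr_sqrtr.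
Qed.

Let a2 : a \in Lfun P 2%:E.
Proof. by apply: Lfun2B; [exact: Lfun2_sqrt_density|exact: Lfun2_cst]. Qed.

Let phi_bounded : \forall z \ae P, `|phi z| <= A.
Proof.
move: fm f'm; apply: filterS2 => z h1 h2.
exact: ler_normB2.
Qed.

Let psi_bounded : \forall z \ae P, `|psi z| <= A.
Proof.
move: hm h'm; apply: filterS2 => z h1 h2.
exact: ler_normB2.
Qed.

Let phi2 : phi \in Lfun P 2%:E.
Proof. exact: ae_bounded_Lfun2 phi_bounded. Qed.

Let psi2 : psi \in Lfun P 2%:E.
Proof. exact: ae_bounded_Lfun2 psi_bounded. Qed.

Lemma Lfun2_expansion_size : kappa \in Lfun P 2%:E.
Proof. by apply: Lfun2D; [apply: Lfun2D|]; exact: Lfun2_norm. Qed.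

Let k1i : P.-Rintegrable kappa.
Proof. exact/Lfun2_integrable/Lfun2_expansion_size. Qed.

Let k2i : P.-Rintegrable (fun z => kappa z ^+ 2).
Proof. exact/Lfun2_sqr/Lfun2_expansion_size. Qed.

Let mg1 : measurable_fun setT g1. Proof. exact: measurable_centered. Qed.
Let mg2 : measurable_fun setT g2. Proof. exact: measurable_centered. Qed.
Let g1A : \forall z \ae P, `|g1 z| <= A. Proof. exact: centered_bounded. Qed.
Let g2A : \forall z \ae P, `|g2 z| <= A. Proof. exact: centered_bounded. Qed.

Let FE z : F z = g1 z + phi z.
Proof. rewrite /F /g1 /centered /phi; ring. Qed.

Let HE z : H z = g2 z + psi z.
Proof. rewrite /H /g2 /centered /psi; ring. Qed.

Let mF : measurable_fun setT F.
Proof. by apply: measurable_funB => //; exact/measurable_comp_mfun/mE. Qed.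

Let mH : measurable_fun setT H.
Proof. by apply: measurable_funB => //; exact/measurable_comp_mfun/mE. Qed.

Let FA : \forall z \ae P, `|F z| <= A.
Proof.
move: f'm (ae_distribution (cond_expectation_bounded C fi fm)).
by apply: filterS2 => z h1 h2; exact: ler_normB2.
Qed.

Let HA : \forall z \ae P, `|H z| <= A.
Proof.
move: h'm (ae_distribution (cond_expectation_bounded C hi hm)).
by apply: filterS2 => z h1 h2; exact: ler_normB2.
Qed.

Let mN : measurable_fun setT N.
Proof.
by apply: measurable_funB; [exact: measurable_funM|exact: measurable_comp_mfun].
Qed.

Let NA : \forall z \ae P, `|N z| <= 2 * A ^+ 2.
Proof.
move: (ae_distribution covA) (centered_mul_bounded C fi hi fm hm).
apply: filterS2 => z h1 h2.
exact: ler_normB2.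
Qed.

Let Ni : P.-Rintegrable N.
Proof. exact: ae_bounded_integrable NA. Qed.

Lemma Lfun2_cov_linear : ell \in Lfun P 2%:E.
Proof.
apply: Lfun2D; first apply: Lfun2D.
- exact: (Lfun2_ae_bounded (Lfun2Z 2 a2) mN NA).
- exact: (Lfun2_ae_bounded phi2 mg2 g2A).
- exact: (Lfun2_ae_bounded psi2 mg1 g1A).
Qed.

Let elli : P.-Rintegrable ell.
Proof. exact/Lfun2_integrable/Lfun2_cov_linear. Qed.

Lemma cond_expectation_cov_residual : \forall x \ae PX, E N x = 0.
Proof.
have Ei := integrable_cond_expectation C (centered_mul_integrable C fi hi fm hm).
have ECi : P.-Rintegrable (fun z => cov (C z)).
  exact/Rintegrable_distributionP.
move: (cond_expectationB C (centered_mul_integrable C fi hi fm hm) ECi).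
by move: (cond_expectation_comp Ei); apply: filterS2 => x -> ->; rewrite subrr.
Qed.

(** Pointwise errors of first and second order in kappa become E kappa and E kappa^2; c1 = 0 keeps a
    purely quadratic error. *)
Let E_close (k l : Z -> R) (c1 c2 : R) : P.-Rintegrable k -> P.-Rintegrable l ->
  (\forall z \ae P, `|k z - l z| <= c1 * kappa z + c2 * kappa z ^+ 2) ->
  \forall x \ae PX, `|E k x - E l x| <=
    c1 * E kappa x + c2 * E (fun z => kappa z ^+ 2) x.
Proof.
move=> ki li kl; have c1i := RintegrableZ c1 k1i; have c2i := RintegrableZ c2 k2i.
have := cond_expectation_abs_le C (RintegrableB ki li) (RintegrableD c1i c2i) kl.
move: (cond_expectationZ C c1 k1i) (cond_expectationZ C c2 k2i) => h1 h2.
have h3 : \forall x \ae PX, E (fun z => c1 * kappa z + c2 * kappa z ^+ 2) x =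
    c1 * E kappa x + c2 * E (fun z => kappa z ^+ 2) x.
  by move: (cond_expectationD C c1i c2i) h1 h2; apply: filterS3 => x -> -> ->.
by move: (cond_expectationB C ki li) h3; apply: filterS3 => x -> ->.
Qed.

Let kappa_ge0 z : 0 <= kappa z.
Proof. by rewrite /kappa !addr_ge0. Qed.

Let alpha_ge0 : \forall x \ae PX, 0 <= E kappa x.
Proof. exact: cond_expectation_ge0 (aeW _ kappa_ge0). Qed.

Let b_close : \forall x \ae PX,
  `|E p x - 1| <= 2 * E kappa x + E (fun z => kappa z ^+ 2) x.
Proof.
have i1 : P.-Rintegrable (fun=> 1) by exact: finite_measure_integrable_cst.
have := @E_close p (fun=> 1) 2 1 pI i1.
have kl : \forall z \ae P, `|p z - 1| <= 2 * kappa z + 1 * kappa z ^+ 2.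
  apply: filterS p_sqr => z ->.
  rewrite (_ : _ - 1 = 2 * a z + a z ^+ 2); last by ring.
  have ak : `|a z| <= kappa z by rewrite /kappa -addrA lerDl addr_ge0.
  have := ler_normD (2 * a z) (a z ^+ 2); rewrite normrM normrX ger0_norm//.
  have : `|a z| ^+ 2 <= kappa z ^+ 2 by rewrite lerXn2r// nnegrE.
  lra.
move=> /(_ kl); move: (cond_expectation_cst P C 1).
by apply: filterS2 => x ->; rewrite mul1r.
Qed.

Let ell_close : \forall x \ae PX, `|E ell x| <= B * E kappa x.
Proof.
have kl : \forall z \ae P, `|ell z| <= B * kappa z.
  move: g1A g2A (ae_distribution covA); apply: filterS3 => z h1 h2 h3.
  exact: cov_linear_bound.
move: (cond_expectation_abs_le C elli (RintegrableZ B k1i) kl).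
by move: (cond_expectationZ C B k1i); apply: filterS2 => x ->.
Qed.

Let pmul_integrable (k : Z -> R) (K : R) : measurable_fun setT k ->
  (\forall z \ae P, `|k z| <= K) -> P.-Rintegrable (fun z => p z * k z).
Proof. by move=> mk kK; exact: (Rintegrable_ae_bounded pI mk kK). Qed.

(** E g1 = 0, so E (p F) is the conditional mean of the small difference p F - g1. *)
Let pF_close : \forall x \ae PX, `|E (fun z => p z * F z) x| <=
    B * E kappa x + B * E (fun z => kappa z ^+ 2) x.
Proof.
have pFi := pmul_integrable mF FA.
have g1i : P.-Rintegrable g1 by exact: ae_bounded_integrable g1A.
have kl : \forall z \ae P, `|p z * F z - g1 z| <= B * kappa z + B * kappa z ^+ 2.
  move: p_sqr FA; apply: filterS2 => z ->; rewrite FE => FAz.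
  apply: le_trans (mean_quadratic_bound (a z) A1 FAz) _.
  have k0 : `|a z| + `|phi z| <= kappa z by rewrite /kappa lerDl.
  have B0 : 0 <= B by exact: le_trans B1.
  by rewrite lerD// ler_wpM2l// lerXn2r// nnegrE addr_ge0.
move: (cond_expectation_centered C fi) (E_close pFi g1i kl).
by apply: filterS2 => x ->; rewrite subr0.
Qed.

Let pH_close : \forall x \ae PX, `|E (fun z => p z * H z) x| <=
    B * E kappa x + B * E (fun z => kappa z ^+ 2) x.
Proof.
have pHi := pmul_integrable mH HA.
have g2i : P.-Rintegrable g2 by exact: ae_bounded_integrable g2A.
have kl : \forall z \ae P, `|p z * H z - g2 z| <= B * kappa z + B * kappa z ^+ 2.
  move: p_sqr HA; apply: filterS2 => z ->; rewrite HE => HAz.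
  apply: le_trans (mean_quadratic_bound (a z) A1 HAz) _.
  have k0 : `|a z| + `|psi z| <= kappa z by rewrite /kappa addrAC lerDl.
  have B0 : 0 <= B by exact: le_trans B1.
  by rewrite lerD// ler_wpM2l// lerXn2r// nnegrE addr_ge0.
move: (cond_expectation_centered C hi) (E_close pHi g2i kl).
by apply: filterS2 => x ->; rewrite subr0.
Qed.

Let pFHi : P.-Rintegrable (fun z => p z * (F z * H z - cov (C z))).
Proof.
apply: (@pmul_integrable _ (A * A + A ^+ 2)).
  by apply: measurable_funB; [exact: measurable_funM|exact: measurable_comp_mfun].
move: FA HA (ae_distribution covA); apply: filterS3 => z h1 h2 h3.
exact: ler_normB_le (ler_normM_le h1 h2) h3.
Qed.

(** E N = 0, so ell may be replaced by N + ell, to which the quadratic pointwise bound applies. *)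
Let pFH_close : \forall x \ae PX,
  `|E (fun z => p z * (F z * H z - cov (C z))) x - E ell x| <=
    B * E (fun z => kappa z ^+ 2) x.
Proof.
have kl : \forall z \ae P, `|p z * (F z * H z - cov (C z)) - (N z + ell z)| <=
    0 * kappa z + B * kappa z ^+ 2.
  have g12 : \forall z \ae P, `|g1 z| <= A /\ `|g2 z| <= A.
    by move: g1A g2A; apply: filterS2.
  have FH12 : \forall z \ae P, `|F z| <= A /\ `|H z| <= A.
    by move: FA HA; apply: filterS2.
  have pc : \forall z \ae P, p z = (1 + a z) ^+ 2 /\ `|cov (C z)| <= A ^+ 2.
    by move: p_sqr (ae_distribution covA); apply: filterS2.
  move: g12 FH12 pc; apply: filterS3 => z [h1 h2] [] + + [-> h5].
  rewrite FE HE => h3 h4; rewrite mul0r add0r.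
  exact: cov_quadratic_bound.
move: (E_close pFHi (RintegrableD Ni elli) kl) (cond_expectationD C Ni elli).
move: cond_expectation_cov_residual; apply: filterS3 => x e0 le e1.
by move: le; rewrite e1 e0 add0r mul0r add0r.
Qed.

Let E_mulw (w : X -> R) (k : Z -> R) (K K' : R) : measurable_fun setT w ->
  (\forall x \ae PX, `|w x| <= K) -> measurable_fun setT k ->
  (\forall z \ae P, `|k z| <= K') ->
  P.-Rintegrable (fun z => w (C z) * (p z * k z)) /\
  \forall x \ae PX, E (fun z => w (C z) * (p z * k z)) x =
    w x * E (fun z => p z * k z) x.
Proof.
move=> mw wK mk kK'; have pki := pmul_integrable mk kK'.
have wpki : P.-Rintegrable (fun z => w (C z) * (p z * k z)).
  have := Rintegrable_ae_bounded pki (measurable_comp_mfun C mw) (ae_distribution wK).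
  by apply: eq_integrable => // z _ /=; rewrite mulrC.
by split => //; exact: cond_expectation_pull_out.
Qed.

(** Functions of C are pulled out of E p by taking k = 1 in [E_mulw]; this removes the factor 1. *)
Let Ep1 x : E (fun z => p z * 1) x = E p x.
Proof. by congr (E _ x); apply/funext => z; rewrite mulr1. Qed.

Let cst1 : \forall z \ae P, `|1 : R| <= 1.
Proof. by apply: aeW => z; rewrite normr1. Qed.

(** Bayes' formula gives E (p f') = E' f' * E p, and the unperturbed mean E f is pulled out of E. *)
Let EpF : \forall x \ae PX, E (fun z => p z * F z) x = z1 x * E p x.
Proof.
have [i e] := E_mulw (mE fi) (cond_expectation_bounded C fi fm) (measurable_cst (1 : R)) cst1.
have pf'i := pmul_integrable mf' f'm.
move: e (cond_expectation_bayes C P'P f'i') (cond_expectationB C pf'i i).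
apply: filterS3 => x e1 e2; rewrite e1 e2 Ep1 -mulrBl => <-.
by congr (E _ x); apply/funext => z; rewrite /F mulr1 mulrBr; congr (_ - _); exact: mulrC.
Qed.

Let EpH : \forall x \ae PX, E (fun z => p z * H z) x = z2 x * E p x.
Proof.
have [i e] := E_mulw (mE hi) (cond_expectation_bounded C hi hm) (measurable_cst (1 : R)) cst1.
have ph'i := pmul_integrable mh' h'm.
move: e (cond_expectation_bayes C P'P h'i') (cond_expectationB C ph'i i).
apply: filterS3 => x e1 e2; rewrite e1 e2 Ep1 -mulrBl => <-.
by congr (E _ x); apply/funext => z; rewrite /H mulr1 mulrBr; congr (_ - _); exact: mulrC.
Qed.

(** With F' and H' centred at the means under P', F H = F' H' + z1 H + z2 F - z1 z2 (z1, z2 taken at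
    C). Bayes' formula treats F' H', and each of z1 H and z2 F contributes z1 z2 E p, so one such
    term remains. *)
Let EpFH : \forall x \ae PX,
  E (fun z => p z * (F z * H z - cov (C z))) x = y x * E p x.
Proof.
have ri' := centered_mul_integrable C f'i' h'i' (ae_dominates P'P f'm)
  (ae_dominates P'P h'm).
have pri := Rintegrable_mul_density P'P ri'.
have e0 := cond_expectation_bayes C P'P ri'.
have [i1 e1] := E_mulw mz1 z1A mH HA.
have [i2 e2] := E_mulw mz2 z2A mF FA.
have mw : measurable_fun setT (fun x => - (z1 x * z2 x + cov x)).
  apply: measurableT_comp => //; apply: measurable_funD => //.
  exact: measurable_funM.
have wK : \forall x \ae PX, `|- (z1 x * z2 x + cov x)| <= A * A + A ^+ 2.
  move: z1A z2A covA; apply: filterS3 => x h1 h2 h3; rewrite normrN.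
  exact: ler_normD_le (ler_normM_le h1 h2) h3.
have [i3 e3] := E_mulw mw wK (measurable_cst (1 : R)) cst1.
have d1 := cond_expectationD C pri i1.
have d2 := cond_expectationD C i2 i3.
have d3 := cond_expectationD C (RintegrableD pri i1) (RintegrableD i2 i3).
have {d1 d2 d3} d := filterS3 _ _ d1 d2 d3.
have {}d : \forall x \ae PX, E (fun z => p z * (F z * H z - cov (C z))) x =
    E (fun z => p z * (centered P' C f' z * centered P' C h' z)) x +
    E (fun z => z1 (C z) * (p z * H z)) x + (E (fun z => z2 (C z) * (p z * F z)) x +
    E (fun z => - (z1 (C z) * z2 (C z) + cov (C z)) * (p z * 1)) x).
  apply: d => x d1 d2; rewrite d1 d2 => <-; congr (E _ x); apply/funext => z.
  rewrite /centered /F /H /z1 /z2 /cst; ring.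
have {}e1 : \forall x \ae PX, E (fun z => z1 (C z) * (p z * H z)) x =
    z1 x * (z2 x * E p x).
  by move: e1 EpH; apply: filterS2 => x -> ->.
have {}e2 : \forall x \ae PX, E (fun z => z2 (C z) * (p z * F z)) x =
    z2 x * (z1 x * E p x).
  by move: e2 EpF; apply: filterS2 => x -> ->.
have e12 : \forall x \ae PX,
  E (fun z => z1 (C z) * (p z * H z)) x + E (fun z => z2 (C z) * (p z * F z)) x =
  2 * (z1 x * z2 x * E p x).
  by move: e1 e2; apply: filterS2 => x -> ->; ring.
have e03 : \forall x \ae PX,
  E (fun z => p z * (centered P' C f' z * centered P' C h' z)) x +
  E (fun z => - (z1 (C z) * z2 (C z) + cov (C z)) * (p z * 1)) x =
  (cov' x - z1 x * z2 x - cov x) * E p x.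
  by move: e0 e3; apply: filterS2 => x -> ->; rewrite Ep1 /cond_covariance; ring.
have perm (q1 q2 q3 q4 : R) : q1 + q2 + (q3 + q4) = (q1 + q4) + (q2 + q3).
  by ring.
move: d e12 e03; apply: filterS3 => x dx e12' e03'.
apply: (eq_trans dx); apply: (eq_trans (perm _ _ _ _)).
apply: (eq_trans (f_equal2 +%R e03' e12')); rewrite /y.
by move: (cov' x) (cov x) (z1 x) (z2 x) (E p x) => q1 q2 q3 q4 q5; ring.
Qed.

(** Instance of [cov_remainder_bound] with b = E p, alpha = E kappa and beta = E kappa^2, where
    alpha^2 <= beta is Jensen's inequality. *)
Lemma cov_expansion : \forall x \ae PX, (cov' x - cov x - E ell x) ^+ 2 <=
  (41 * B ^+ 2) ^+ 2 * (E (fun z => kappa z ^+ 2) x *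
                        Num.min (E (fun z => kappa z ^+ 2) x) 1).
Proof.
have BA : A <= B.
  have : A <= A ^+ 2 by rewrite expr2 ler_peMr// (le_trans _ A1).
  rewrite /B; have := sqr_ge0 A; move: (A ^+ 2) (A) => t t'; lra.
have y' : \forall x \ae PX, `|y x * E p x - E ell x| <=
    B * E (fun z => kappa z ^+ 2) x.
  by move: EpFH pFH_close; apply: filterS2 => x ->.
have z1' : \forall x \ae PX, `|z1 x * E p x| <=
    B * E kappa x + B * E (fun z => kappa z ^+ 2) x.
  by move: EpF pF_close; apply: filterS2 => x ->.
have z2' : \forall x \ae PX, `|z2 x * E p x| <=
    B * E kappa x + B * E (fun z => kappa z ^+ 2) x.
  by move: EpH pH_close; apply: filterS2 => x ->.
near=> x.
have -> : cov' x - cov x - E ell x = y x - z1 x * z2 x - E ell x by rewrite /y; ring.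
apply: (cov_remainder_bound (b := E p x) B1 (alpha := E kappa x)).
- by near: x; exact: alpha_ge0.
- by near: x; exact/cond_expectation_sqr/Lfun2_expansion_size.
- by near: x.
- by near: x; exact: ell_close.
- by near: x; exact: b_close.
- by near: x.
- by near: x.
- by near: x; exact: yB.
- by apply: le_trans BA; near: x; exact: z1A.
- by apply: le_trans BA; near: x; exact: z2A.
Unshelve. all: by end_near. Qed.

End covariance_expansion.

(** * Remainder along paths *)

Lemma Rintegral_tail_small (d : measure_display) (T : measurableType d)
    (R : realType) (mu : {measure set T -> \bar R}) (k : T -> R) (eta : R) :
  mu.-Rintegrable k -> 0 < eta -> exists2 K, 0 < K &
    \int[mu]_(x in [set x | K <= `|k x|]) `|k x| <= eta.
Proof.
move=> ki eta0; have [delta [delta0 small]] := integral_normr_continuous ki eta0.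
have nki := integrable_norm ki.
have V0 : 0 <= \int[mu]_x `|k x| by exact: Rintegral_ge0.
set V := \int[mu]_x `|k x| in V0.
(* Markov's inequality bounds the measure of {|k| >= K} by V / K, which is below delta for this K;
   adding 1 makes K positive and the inequality strict. *)
have K0 : 0 < (V + 1) / delta by rewrite divr_gt0// ltr_wpDl.
exists ((V + 1) / delta) => //; set K := _ / _ in K0 *; rewrite ltW//.
have mk : measurable_fun setT (fun x => `|k x|).
  exact: Rintegrable_measurable nki.
apply: small.
  have -> : [set x | K <= `|k x|] = (fun x => `|k x|) @^-1` `[K, +oo[.
    by apply/seteqP; split => x /=; rewrite in_itv/= andbT.
  by rewrite -[_ @^-1` _]setTI; exact: mk.
have := @le_integral_abse _ _ _ mu setT measurableT (EFin \o k) K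
  (measurable_int _ ki) K0.
rewrite setTI (_ : (\int[mu]_x _)%E = V%:E); last first.
  by rewrite /V /Rintegral fineK//; exact: integrable_fin_num nki.
move=> KV.
rewrite -(@lte_pmul2l _ K%:E)// ?lte_fin//.
apply: (le_lt_trans KV); rewrite -EFinM lte_fin /K mulfVK ?gt_eqF//.
by rewrite ltrDl.
Qed.

Lemma Rintegral_mul_indic (d : measure_display) (T : measurableType d)
    (R : realType) (mu : {measure set T -> \bar R}) (A : set T) (k : T -> R) :
  \int[mu]_(x in A) k x = \int[mu]_x (\1_A x * k x).
Proof.
rewrite Rintegral_mkcond; apply: eq_Rintegral => x _.
by rewrite /patch indicE; case: ifP; rewrite ?mul1r ?mul0r.
Qed.

Section remainder_bound.
Context (dZ dX : measure_display) (Z : measurableType dZ)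
  (X : measurableType dX) (R : realType).
Variables (P : probability Z R) (C : {mfun Z >-> X}).
Local Notation PX := (distribution P C).
Local Notation E := (cond_expectation P C).

(** The weight min (beta, 1) is a function of C, so the tower property places it next to kappa^2
    under P, where the pointwise bound on kappa applies. *)
Lemma min_cond_expectation_sqr_bound (kappa S rho : Z -> R) (e K : R) :
  kappa \in Lfun P 2%:E -> S \in Lfun P 2%:E -> rho \in Lfun P 2%:E ->
  0 < K -> (\forall z \ae P, `|kappa z| <= e * S z + rho z) ->
  let beta := E (fun z => kappa z ^+ 2) in
  PX.-Rintegrable (fun x => beta x * Num.min (beta x) 1) /\
  \int[PX]_x (beta x * Num.min (beta x) 1) <=
    2 * e ^+ 2 * \int[P]_(z in [set z | K <= `|S z ^+ 2|]) `|S z ^+ 2| +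
    2 * e ^+ 2 * K * (2 * e ^+ 2 * \int[P]_z (S z ^+ 2) + 2 * \int[P]_z (rho z ^+ 2)) +
    2 * \int[P]_z (rho z ^+ 2).
Proof.
move=> kappa2 S2 rho2 K0 kappale beta.
have [[ki Si] rhoi] := (Lfun2_sqr kappa2, Lfun2_sqr S2, Lfun2_sqr rho2).
have betai : PX.-Rintegrable beta by exact: integrable_cond_expectation.
have mbeta := Rintegrable_measurable betai.
pose w x := Num.min (beta x) 1.
have mw : measurable_fun setT w by exact: measurable_minr.
have beta0 : \forall x \ae PX, 0 <= beta x.
  by apply: cond_expectation_ge0 => //; apply: aeW => z; exact: sqr_ge0.
have w01 : \forall x \ae PX, 0 <= w x <= 1.
  by apply: filterS beta0 => x b0; rewrite /w le_min b0 ler01 ge_min lexx orbT.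
have wC : \forall z \ae P, 0 <= w (C z) <= 1 := ae_distribution w01.
have wCn : \forall z \ae P, `|w (C z)| <= 1.
  by apply: filterS wC => z /andP[w0 w1]; rewrite ger0_norm.
have mwC := measurable_comp_mfun C mw.
have wki : P.-Rintegrable (fun z => w (C z) * kappa z ^+ 2).
  have := Rintegrable_ae_bounded ki mwC wCn.
  by apply: eq_integrable => // z _ /=; rewrite mulrC.
have [wbi wb] := tower ki mw wki.
have bE : (fun x => beta x * Num.min (beta x) 1) = (fun x => w x * beta x).
  by apply/funext => x; rewrite mulrC.
split; first by rewrite bE.
rewrite bE wb.
have kle : \forall z \ae P, kappa z ^+ 2 <= 2 * e ^+ 2 * S z ^+ 2 + 2 * rho z ^+ 2.
  apply: filterS kappale => z kz.
  have h : kappa z ^+ 2 <= (e * S z + rho z) ^+ 2.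
    by rewrite -real_normK ?num_real// lerXn2r// nnegrE (le_trans _ kz).
  apply: (le_trans h); rewrite -subr_ge0.
  by rewrite (_ : _ - _ = (e * S z - rho z) ^+ 2) ?sqr_ge0//; ring.
set A := [set z | K <= `|S z ^+ 2|].
have mA : measurable A.
  have mS : measurable_fun setT (fun z => `|S z ^+ 2|).
    exact: Rintegrable_measurable (integrable_norm Si).
  have -> : A = (fun z => `|S z ^+ 2|) @^-1` `[K, +oo[.
    by apply/seteqP; split => z /=; rewrite in_itv/= andbT.
  by rewrite -[_ @^-1` _]setTI; exact: mS.
have ISi : P.-Rintegrable (fun z => \1_A z * `|S z ^+ 2|).
  apply: (Rintegrable_le _ (integrable_norm Si)).
    apply: measurable_funM; first exact: measurable_indic.
    exact: Rintegrable_measurable (integrable_norm Si).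
  move=> z; rewrite normrM normr_id indicE /=; case: (_ \in _);
    by rewrite ?normr1 ?normr0 ?mul1r ?mul0r.
have bCi : P.-Rintegrable (fun z => beta (C z)) by exact/Rintegrable_distributionP.
have Cbeta : \int[P]_z beta (C z) = \int[P]_z (kappa z ^+ 2).
  by rewrite -(Rintegral_distribution betai) Rintegral_cond_expectation.
have le1 : \int[P]_z (kappa z ^+ 2) <=
    2 * e ^+ 2 * \int[P]_z (S z ^+ 2) + 2 * \int[P]_z (rho z ^+ 2).
  have [i1 i2] := (RintegrableZ (2 * e ^+ 2) Si, RintegrableZ 2 rhoi).
  have := ae_le_Rintegral ki (RintegrableD i1 i2) kle.
  by rewrite RintegralD// !RintegralZl.
have i1 := RintegrableZ (2 * e ^+ 2) ISi.
have i2 := RintegrableZ (2 * e ^+ 2 * K) bCi.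
have i3 := RintegrableZ 2 rhoi.
have le2 : \int[P]_z (w (C z) * kappa z ^+ 2) <=
    \int[P]_z (2 * e ^+ 2 * (\1_A z * `|S z ^+ 2|) + 2 * e ^+ 2 * K * beta (C z) +
      2 * rho z ^+ 2).
  apply: ae_le_Rintegral => //; first exact/RintegrableD/i3/RintegrableD.
  move: kle wC (ae_distribution beta0); apply: filterS3 => z kz /andP[w0 w1] b0.
  have e0 : 0 <= e ^+ 2 by exact: sqr_ge0.
  have S0 : 0 <= S z ^+ 2 by exact: sqr_ge0.
  have r0 : 0 <= rho z ^+ 2 by exact: sqr_ge0.
  have h1 : w (C z) * kappa z ^+ 2 <=
      2 * (e ^+ 2 * (w (C z) * S z ^+ 2)) + 2 * rho z ^+ 2.
    apply: (le_trans (ler_wpM2l w0 kz)); rewrite mulrDr lerD//.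
      by rewrite le_eqVlt; apply/orP; left; apply/eqP; ring.
    by rewrite ler_piMl// mulr_ge0.
  move: e0 h1; move: (e ^+ 2) => t t0 h1.
  apply: (le_trans h1); rewrite lerD2r -!mulrA -mulrDr ler_wpM2l//.
  rewrite -mulrDr ler_wpM2l//.
  have wb' : w (C z) <= beta (C z) by rewrite /w ge_min lexx.
  (* On A the weight is at most 1; off A, S^2 < K and the weight is at most beta, whose integral is
     again that of kappa^2. *)
  have [zA|zA] := boolP (z \in A).
    rewrite indicE zA mul1r ger0_norm//.
    have h : 0 <= K * beta (C z) by rewrite mulr_ge0// ltW.
    have : w (C z) * S z ^+ 2 <= S z ^+ 2 by rewrite ler_piMl.
    lra.
  rewrite indicE (negbTE zA) mul0r add0r mulrC ler_pM//.
  move: zA; rewrite notin_setE /A /= => /negP; rewrite -ltNge ger0_norm//.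
  exact: ltW.
apply: (le_trans le2); rewrite RintegralD//; last exact: RintegrableD.
rewrite RintegralD// !RintegralZl// -Rintegral_mul_indic Cbeta !lerD2r lerD2l.
by apply: ler_wpM2l => //; rewrite mulr_ge0 ?(ltW K0)// mulr_ge0// sqr_ge0.
Qed.

End remainder_bound.

(** * From the truncation bound to o(e) *)

Lemma littleo0P (R : realType) (f g : R -> R) : Defs.littleo0 f g <->
  forall eps, 0 < eps -> \forall e \near 0^'+, `|f e| <= eps * `|g e|.
Proof.
rewrite /Defs.littleo0; split=> [h eps eps0|h].
  exact: ((eqoP _ _ _).1 h).
exact/((eqoP _ _ _).2 h).
Qed.

(** n2 is the squared error, W the integral of rho^2, V that of S^2 and T its tail. K is fixed
    through the tail first; then the term carrying K is of order e^4 once W <= e^2. *)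
Lemma littleo0_sqrt_bound (R : realType) (n2 W T : R -> R) (c1 c2 V : R) :
  0 <= c1 -> 0 <= c2 -> 0 <= V ->
  (forall eta, 0 < eta -> exists2 K, 0 < K & T K <= eta) ->
  (forall eta, 0 < eta -> \forall e \near 0^'+, W e <= eta * e ^+ 2) ->
  (\forall e \near 0^'+, 0 <= W e /\ forall K, 0 < K -> n2 e <=
    c1 * (2 * e ^+ 2 * T K + 2 * e ^+ 2 * K * (2 * e ^+ 2 * V + 2 * W e) + 2 * W e) +
    c2 * W e) ->
  Defs.littleo0 (fun e => Num.sqrt (n2 e)) (fun e => e).
Proof.
move=> c10 c20 V0 tail Wo bound; apply/littleo0P => eps eps0.
(* The tail, the term with K and the terms in W each receive eps^2 e^2 / 4. The added 1 in the
   denominators keeps them positive when c1 and c2 vanish. *)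
have [K K0 TK] : exists2 K, 0 < K & T K <= eps ^+ 2 / (8 * (c1 + 1)).
  by apply: tail; rewrite divr_gt0 ?exprn_gt0// mulr_gt0// ltr_wpDl.
pose eta := Num.min 1 (eps ^+ 2 / (4 * (2 * c1 + c2 + 1))).
have c120 : 0 < 2 * c1 + c2 + 1 by rewrite ltr_wpDl// addr_ge0// mulr_ge0.
have eta0 : 0 < eta.
  by rewrite lt_min ltr01 divr_gt0// ?exprn_gt0// mulr_gt0.
have dd0 : 0 < 4 * (4 * c1 * K * (V + 1) + 1).
  by rewrite mulr_gt0// ltr_wpDl// !mulr_ge0 ?(ltW K0)// ?addr_ge0// mulr_ge0.
pose d := Num.min 1 (eps ^+ 2 / (4 * (4 * c1 * K * (V + 1) + 1))).
have d0 : 0 < d by rewrite lt_min ltr01 divr_gt0// exprn_gt0.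
near=> e.
have e0 : 0 < e by near: e; exact: nbhs_right_gt.
have ed : e <= d by near: e; exact: nbhs_right_le.
have We : W e <= eta * e ^+ 2 by near: e; exact: Wo.
have [W0 /(_ K K0) b] : 0 <= W e /\ forall K, 0 < K -> n2 e <=
    c1 * (2 * e ^+ 2 * T K + 2 * e ^+ 2 * K * (2 * e ^+ 2 * V + 2 * W e) + 2 * W e) +
    c2 * W e by near: e.
rewrite ger0_norm ?sqrtr_ge0// (ger0_norm (ltW e0)).
have ee0 : 0 <= eps * e by rewrite mulr_ge0// ltW.
rewrite -[leRHS]ger0_norm// -sqrtr_sqr ler_wsqrtr// (le_trans b)// exprMn.
(* d <= 1 gives e^2 <= e <= d. *)
have e2 : e ^+ 2 <= d.
  rewrite expr2 (le_trans _ ed)// ger_pMl// (le_trans ed)//.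
  by rewrite /d ge_min lexx.
set t := e ^+ 2 in e2 We b *.
have t0 : 0 <= t by exact: sqr_ge0.
have h1 : 8 * (c1 + 1) * T K <= eps ^+ 2.
  by rewrite mulrC -ler_pdivlMr// mulr_gt0// ltr_wpDl.
have h2 : 4 * (2 * c1 + c2 + 1) * eta <= eps ^+ 2.
  rewrite mulrC -ler_pdivlMr; last by rewrite mulr_gt0.
  by rewrite /eta ge_min lexx orbT.
have eta1 : eta <= 1 by rewrite /eta ge_min lexx.
have h3 : 4 * (4 * c1 * K * (V + 1) + 1) * t <= eps ^+ 2.
  rewrite mulrC -ler_pdivlMr// (le_trans e2)//.
  by rewrite /d ge_min lexx orbT.
have Wt : W e <= t by apply: (le_trans We); rewrite ler_piMl.
have h4 : 2 * t * K * (2 * t * V + 2 * W e) <= 4 * K * (V + 1) * t * t.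
  rewrite (_ : 4 * K * (V + 1) * t * t = 2 * t * K * (2 * t * V + 2 * t)); last by ring.
  apply: ler_wpM2l; first by rewrite !mulr_ge0// ltW.
  by rewrite lerD2l ler_wpM2l.
have h5 : c1 * (2 * t * K * (2 * t * V + 2 * W e)) <= c1 * (4 * K * (V + 1) * t * t).
  exact: ler_wpM2l.
have h6 : 4 * c1 * K * (V + 1) * t * t <= eps ^+ 2 / 4 * t.
  apply: ler_wpM2r => //; lra.
have h7 : (2 * c1 + c2) * W e <= (2 * c1 + c2) * (eta * t).
  by apply: ler_wpM2l => //; rewrite addr_ge0// mulr_ge0.
have h8 : (2 * c1 + c2) * eta * t <= eps ^+ 2 / 4 * t.
  by apply: ler_wpM2r => //; lra.
have h9 : 2 * c1 * T K * t <= eps ^+ 2 / 4 * t.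
  apply: ler_wpM2r => //.
  have [T0|T0] := leP 0 (T K); first by lra.
  have : c1 * T K <= 0 by rewrite mulr_ge0_le0// ltW.
  have := sqr_ge0 eps; lra.
have h10 : 0 <= eps ^+ 2 * t by rewrite mulr_ge0// sqr_ge0.
lra.
Unshelve. all: by end_near. Qed.

(** * Derivative integrand and integrated error *)

Section cov_derivative.
Context (dZ dX : measure_display) (Z : measurableType dZ)
  (X : measurableType dX) (R : realType).
Variables (P : probability Z R) (C : {mfun Z >-> X}).
Local Notation PX := (distribution P C).
Local Notation E := (cond_expectation P C).
Variables (f h : Z -> R) (m : R).
Hypotheses (m1 : 1 <= m) (mf : measurable_fun setT f) (mh : measurable_fun setT h)
  (fm : \forall z \ae P, `|f z| <= m) (hm : \forall z \ae P, `|h z| <= m).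

(* The integrand whose conditional expectation is the derivative of the
   conditional covariance in the direction (s, (t1, t2)). *)
Definition cov_derivative (s t1 t2 : Z -> R) z :=
  s z * cov_residual P C f h z +
  (t1 z * centered P C h z + t2 z * centered P C f z).

Let fi : P.-Rintegrable f.  Proof. exact: ae_bounded_integrable fm. Qed.
Let hi : P.-Rintegrable h.  Proof. exact: ae_bounded_integrable hm. Qed.

Lemma measurable_cond_covariance : measurable_fun setT (cond_covariance P C f h).
Proof. exact: (measurable_cond_expectation C (centered_mul_integrable C fi hi fm hm)). Qed.

Lemma measurable_cov_residual : measurable_fun setT (cov_residual P C f h).
Proof.
apply: measurable_funB; last exact/measurable_comp_mfun/measurable_cond_covariance.
by apply: measurable_funM; exact: measurable_centered.
Qed.

Lemma cov_residual_bounded :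
  \forall z \ae P, `|cov_residual P C f h z| <= 2 * (2 * m) ^+ 2.
Proof.
move: (ae_distribution (cond_covariance_bounded C fi hi fm hm)).
move: (centered_mul_bounded C fi hi fm hm); apply: filterS2 => z h1 h2.
exact: ler_normB2.
Qed.

Lemma Lfun2_cov_derivative s t1 t2 : s \in Lfun P 2%:E -> t1 \in Lfun P 2%:E ->
  t2 \in Lfun P 2%:E -> cov_derivative s t1 t2 \in Lfun P 2%:E.
Proof.
move=> s2 t12 t22; apply: Lfun2D; last apply: Lfun2D.
- exact: (Lfun2_ae_bounded s2 measurable_cov_residual cov_residual_bounded).
- exact: (Lfun2_ae_bounded t12 (measurable_centered C hi) (centered_bounded C hi hm)).
- exact: (Lfun2_ae_bounded t22 (measurable_centered C fi) (centered_bounded C fi fm)).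
Qed.

Variables (P' : probability Z R) (f' h' : Z -> R).
Hypotheses (P'P : P' `<< P) (PP' : P `<< P')
  (mf' : measurable_fun setT f') (mh' : measurable_fun setT h')
  (f'm : \forall z \ae P, `|f' z| <= m) (h'm : \forall z \ae P, `|h' z| <= m).
Variables (s t1 t2 : Z -> R) (e : R).
Hypotheses (s2 : s \in Lfun P 2%:E) (t12 : t1 \in Lfun P 2%:E)
  (t22 : t2 \in Lfun P 2%:E) (e0 : 0 <= e).
Local Notation p := (density P' P).
Local Notation cov := (cond_covariance P C f h).
Local Notation cov' := (cond_covariance P' C f' h').

Definition score_remainder z := Num.sqrt (p z) - 1 - e / 2 * s z.

Definition direction_size (z : Z) := `|s z| + `|t1 z| + `|t2 z|.

(** The part rho in kappa <= e S + rho, with S = [direction_size]. *)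
Definition remainder_size z :=
  `|score_remainder z| + `|f' z - f z - e * t1 z| + `|h' z - h z - e * t2 z|.

Lemma Lfun2_score_remainder : score_remainder \in Lfun P 2%:E.
Proof.
apply: Lfun2B; last exact: Lfun2Z.
by apply: Lfun2B; [exact: Lfun2_sqrt_density|exact: Lfun2_cst].
Qed.

Lemma Lfun2_direction_size : direction_size \in Lfun P 2%:E.
Proof. by do 2?[apply: Lfun2D]; exact: Lfun2_norm. Qed.

Let f2 : f \in Lfun P 2%:E. Proof. exact: ae_bounded_Lfun2 fm. Qed.
Let h2 : h \in Lfun P 2%:E. Proof. exact: ae_bounded_Lfun2 hm. Qed.
Let f'2 : f' \in Lfun P 2%:E. Proof. exact: ae_bounded_Lfun2 f'm. Qed.
Let h'2 : h' \in Lfun P 2%:E. Proof. exact: ae_bounded_Lfun2 h'm. Qed.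

Let r12 : (fun z => f' z - f z - e * t1 z) \in Lfun P 2%:E.
Proof. by apply: Lfun2B; [exact: Lfun2B|exact: Lfun2Z]. Qed.

Let r22 : (fun z => h' z - h z - e * t2 z) \in Lfun P 2%:E.
Proof. by apply: Lfun2B; [exact: Lfun2B|exact: Lfun2Z]. Qed.

Lemma Lfun2_remainder_size : remainder_size \in Lfun P 2%:E.
Proof.
apply: Lfun2D; last exact: Lfun2_norm.
by apply: Lfun2D; apply: Lfun2_norm; first exact: Lfun2_score_remainder.
Qed.

Let B := 9 * (2 * m) ^+ 2.

Lemma Lfun2_cov_error :
  (fun x => cov' x - cov x - e * E (cov_derivative s t1 t2) x) \in Lfun PX 2%:E.
Proof.
have [f'i' h'i'] : P'.-Rintegrable f' /\ P'.-Rintegrable h'.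
  by split; [apply: (ae_bounded_integrable mf')|apply: (ae_bounded_integrable mh')];
    apply: (ae_dominates P'P); eassumption.
apply: Lfun2B; last first.
  exact/Lfun2Z/Lfun2_cond_expectation/Lfun2_cov_derivative.
apply: Lfun2B; last first.
  apply: ae_bounded_Lfun2 (cond_covariance_bounded C fi hi fm hm).
  exact: measurable_cond_covariance.
have bd := cond_covariance_bounded C f'i' h'i' (ae_dominates P'P f'm) (ae_dominates P'P h'm).
have bd' : \forall x \ae PX, `|cov' x| <= (2 * m) ^+ 2.
  have PXP' : distribution P C `<< distribution P' C.
    exact: null_dominates_distribution.
  exact: (ae_dominates PXP' bd).
apply: ae_bounded_Lfun2 bd'.
apply: measurable_cond_expectation; apply: (centered_mul_integrable C f'i' h'i').
- exact: (ae_dominates P'P f'm).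
- exact: (ae_dominates P'P h'm).
Qed.

(** The error is the expansion error plus E q, where q = ell - e * [cov_derivative]; the leading
    factors 2 come from (a + b)^2 <= 2 a^2 + 2 b^2. The first part goes through the truncation
    bound, the second through Jensen's inequality. *)
Lemma cov_error_bound K : 0 < K ->
  \int[PX]_x (cov' x - cov x - e * E (cov_derivative s t1 t2) x) ^+ 2 <=
  2 * (41 * B ^+ 2) ^+ 2 *
  (2 * e ^+ 2 * \int[P]_(z in [set z | K <= `|direction_size z ^+ 2|])
      `|direction_size z ^+ 2| +
    2 * e ^+ 2 * K * (2 * e ^+ 2 * \int[P]_z (direction_size z ^+ 2) +
      2 * \int[P]_z (remainder_size z ^+ 2)) +
    2 * \int[P]_z (remainder_size z ^+ 2)) +
  2 * B ^+ 2 * \int[P]_z (remainder_size z ^+ 2).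
Proof.
move=> K0; pose kappa := expansion_size P P' f h f' h'.
pose ell := cov_linear P P' C f h f' h'.
pose beta := E (fun z => kappa z ^+ 2).
have k2 : kappa \in Lfun P 2%:E by exact: (Lfun2_expansion_size P'P mf mh mf' mh' fm hm f'm h'm).
have l2 : ell \in Lfun P 2%:E by exact: (Lfun2_cov_linear C P'P mf mh mf' mh' fm hm f'm h'm).
have d2 := Lfun2_cov_derivative s2 t12 t22.
have kle z : kappa z <= e * direction_size z + remainder_size z.
  rewrite /kappa /expansion_size /direction_size /remainder_size.
  (* The factor 1/2 of the score is dropped, so that one S serves all three components. *)
  have n1 : `|Num.sqrt (p z) - 1| <= e * `|s z| + `|score_remainder z|.
    rewrite (_ : _ - 1 = e / 2 * s z + score_remainder z); last first.
      by rewrite /score_remainder; ring.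
    apply: (le_trans (ler_normD _ _)); rewrite lerD2r normrM ger0_norm ?divr_ge0//.
    by rewrite ler_wpM2r// ler_pdivrMr// ler_peMr// ler1n.
  have n2 : `|f' z - f z| <= e * `|t1 z| + `|f' z - f z - e * t1 z|.
    have := ler_normD (e * t1 z) (f' z - f z - e * t1 z).
    by rewrite normrM (ger0_norm e0) addrC subrK.
  have n3 : `|h' z - h z| <= e * `|t2 z| + `|h' z - h z - e * t2 z|.
    have := ler_normD (e * t2 z) (h' z - h z - e * t2 z).
    by rewrite normrM (ger0_norm e0) addrC subrK.
  by move: n1 n2 n3; move: (e) => u; lra.
have knn : \forall z \ae P, `|kappa z| <= e * direction_size z + remainder_size z.
  by apply: aeW => z; rewrite ger0_norm// /kappa /expansion_size !addr_ge0.
have [bi bb] := min_cond_expectation_sqr_bound C k2 Lfun2_direction_size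
  Lfun2_remainder_size K0 knn.
rewrite -/beta in bi bb.
have exp := cov_expansion C P'P PP' m1 mf mh mf' mh' fm hm f'm h'm.
rewrite -/B -/kappa -/ell -/beta in exp.
pose q z := ell z - e * cov_derivative s t1 t2 z.
have q2 : q \in Lfun P 2%:E by apply: Lfun2B => //; exact: Lfun2Z.
have qle : \forall z \ae P, q z ^+ 2 <= B ^+ 2 * remainder_size z ^+ 2.
  have m21 : 1 <= 2 * m by have := m1; move: (m) => u; lra.
  move: (centered_bounded C fi fm) (centered_bounded C hi hm)
    (ae_distribution (cond_covariance_bounded C fi hi fm hm)).
  apply: filterS3 => z c1 c2 c3.
  (* ell is linear in (a, phi, psi) and equals e times the derivative integrand at (e s / 2, e t1, e
     t2); hence q is the same expression at the three remainders. *)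
  have := cov_linear_bound (score_remainder z) (f' z - f z - e * t1 z)
    (h' z - h z - e * t2 z) m21 c1 c2 c3.
  rewrite -/(cov_residual P C f h z).
  have -> : 2 * score_remainder z *
      (centered P C f z * centered P C h z - cov (C z)) +
    (f' z - f z - e * t1 z) * centered P C h z +
    (h' z - h z - e * t2 z) * centered P C f z = q z.
    rewrite /q /ell /cov_linear /cov_derivative /cov_residual /score_remainder.
    set u := cond_covariance _ _ _ _ _; set v := centered P C f z.
    set w := centered P C h z; set r := Num.sqrt _.
    by field.
  rewrite -/B -/(remainder_size z) => qB.
  have Br := le_trans (normr_ge0 _) qB.
  by rewrite -real_normK ?num_real// -exprMn lerXn2r// nnegrE.
have Eq : \forall x \ae PX, E q x = E ell x - e * E (cov_derivative s t1 t2) x.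
  have [li di] := (Lfun2_integrable l2, Lfun2_integrable d2).
  move: (cond_expectationB C li (RintegrableZ e di)) (cond_expectationZ C e di).
  by apply: filterS2 => x -> ->.
have Eq2i := Lfun2_sqr (Lfun2_cond_expectation C q2).
have i1 := RintegrableZ (2 * (41 * B ^+ 2) ^+ 2) bi.
have i2 := RintegrableZ 2 Eq2i.
have main := ae_le_Rintegral (Lfun2_sqr Lfun2_cov_error) (RintegrableD i1 i2).
apply: (le_trans (main _)).
  move: exp Eq; apply: filterS2 => x ex ->.
  have := ex; rewrite -mulrA; set c := (41 * B ^+ 2) ^+ 2 * _ => exc.
  set u := cov' x - cov x in exc *; set v := e * _; set w := E ell x in exc *.
  have -> : u - v = (u - w) + (w - v) by ring.
  have := sqr_ge0 (u - w - (w - v)).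
  by move: (u - w) (w - v) (c) exc => a b c'; rewrite sqrrB sqrrD; lra.
rewrite RintegralD// !RintegralZl// lerD//.
  by apply: ler_wpM2l => //; rewrite mulr_ge0// sqr_ge0.
rewrite -mulrA ler_wpM2l//.
apply: (le_trans (le_Rintegral_cond_expectation_sqr C q2)).
rewrite -RintegralZl//; last exact/Lfun2_sqr/Lfun2_remainder_size.
apply: ae_le_Rintegral => //; first exact: Lfun2_sqr.
exact/RintegrableZ/Lfun2_sqr/Lfun2_remainder_size.
Qed.

End cov_derivative.

(** * Square integrable functions as a prehilbert space, bounded pairs *)

Section L2_facts.
Context (d : measure_display) (T : measurableType d) (R : realType).
Variable mu : {measure set T -> \bar R}.
Implicit Types f g : L2 mu.

(* A named coercion keeps unification from unfolding the module operations. *)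
Definition L2_fun f : T -> R := f.

Lemma L2_Lfun2 f : L2_fun f \in Lfun mu 2%:E.
Proof. exact: LfunP. Qed.

Lemma measurable_L2_fun f : measurable_fun setT (L2_fun f).
Proof. exact: Lfun2_measurable (L2_Lfun2 f). Qed.

Lemma L2_dotE f g : hdot f g = \int[mu]_x (L2_fun f x * L2_fun g x).
Proof. by []. Qed.

Lemma L2_dot_sqr f : hdot f f = \int[mu]_x (L2_fun f x ^+ 2).
Proof. by rewrite L2_dotE; apply: eq_Rintegral => x _; rewrite expr2. Qed.

Lemma L2_dot_ae_sqr f (k : T -> R) : measurable_fun setT k ->
  (\forall x \ae mu, L2_fun f x = k x) -> hdot f f = \int[mu]_x (k x ^+ 2).
Proof.
move=> mk fk; rewrite L2_dot_sqr; apply: ae_eq_Rintegral.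
- exact/measurable_funX/measurable_L2_fun.
- exact: measurable_funX.
- by apply: filterS fk => x ->.
Qed.

Lemma L2_dot_ae_sqr_eq f g : (\forall x \ae mu, L2_fun g x = L2_fun f x) ->
  hdot f f = hdot g g.
Proof.
move=> gf; rewrite (L2_dot_ae_sqr (measurable_L2_fun f) gf); exact: L2_dot_sqr.
Qed.

Lemma L2_hnorm_ae0 f : (\forall x \ae mu, L2_fun f x = 0) -> hnorm f = 0.
Proof.
move=> f0; rewrite /hnorm (@L2_dot_ae_sqr f (cst 0))//.
rewrite (_ : (fun _ => _) = cst 0); last by apply/funext => x; rewrite /= expr0n.
by rewrite Rintegral_cst// mul0r sqrtr0.
Qed.

Lemma L2_funD f g x : L2_fun (f + g) x = L2_fun f x + L2_fun g x.
Proof. by []. Qed.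

Lemma L2_funB f g x : L2_fun (f - g) x = L2_fun f x - L2_fun g x.
Proof. by []. Qed.

Lemma L2_funZ a f x : L2_fun (a *: f) x = a * L2_fun f x.
Proof. by []. Qed.

Lemma L2_class_fun (k : T -> R) : k \in Lfun mu 2%:E ->
  \forall x \ae mu, L2_fun (L2_class mu k) x = k x.
Proof. exact: L2_classP. Qed.

End L2_facts.

Section prehilbert_facts.
Context (R : realType).

Lemma hdot0 (H : prehilbert R) (z : H) : hdot 0 z = 0.
Proof.
have := hdotDl 1 0 0 z; rewrite scaler0 addr0 mul1r => h.
by apply: (addrI (hdot 0 z)); rewrite addr0 -h.
Qed.

Lemma hnorm0 (H : prehilbert R) : hnorm (0 : H) = 0.
Proof. by rewrite /hnorm hdot0 sqrtr0. Qed.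

Lemma hsum_dotE (H1 H2 : prehilbert R) (x y : hsum H1 H2) :
  hdot x y = hdot x.1 y.1 + hdot x.2 y.2.
Proof. by []. Qed.

Lemma hsum_fst (H1 H2 : prehilbert R) (x y t : hsum H1 H2) (e : R) :
  (x - y - e *: t).1 = x.1 - y.1 - e *: t.1.
Proof. by []. Qed.

Lemma hsum_snd (H1 H2 : prehilbert R) (x y t : hsum H1 H2) (e : R) :
  (x - y - e *: t).2 = x.2 - y.2 - e *: t.2.
Proof. by []. Qed.

Lemma lin_span0 (H : prehilbert R) (S : set H) : lin_span S 0.
Proof.
by exists 0%N, (fun=> 0), (fun=> 0); split => [[]//|]; rewrite big_ord0.
Qed.

End prehilbert_facts.

(** * Essential suprema as almost sure bounds *)

Section essential_bounds.
Context (d : measure_display) (T : measurableType d) (R : realType).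

Lemma Lnorm_yE (mu : probability T R) (f : T -> \bar R) :
  'N[mu]_+oo [f]%E = ess_sup mu (abse \o f).
Proof.
have mu0 : (0 < mu setT)%E by rewrite probability_setT.
by rewrite unlock ifT.
Qed.

Lemma Lnorm_y_density_bounded (nu : {finite_measure set T -> \bar R})
    (mu : probability T R) : nu `<< mu ->
  ('N[mu]_+oo ['d (charge_of_finite_measure nu) '/d mu] < +oo)%E ->
  exists2 K : R, 0 <= K & \forall x \ae mu, `|density nu mu x| <= K.
Proof.
move=> numu; rewrite Lnorm_yE.
move: (ess_sup_ge mu (abse \o 'd (charge_of_finite_measure nu) '/d mu)).
set s := ess_sup _ _ => sge soo; exists `|fine s| => //; apply: filterS sge => x /=.
rewrite -EFin_density//= => h; rewrite -lee_fin (le_trans h)//.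
by move: soo h; case: s => [r _ _|//|_ _]; rewrite ?leNye// lee_fin ler_norm.
Qed.

Lemma Lnorm_y_leP (mu : probability T R) (f : T -> R) (m : R) :
  ('N[mu]_+oo [EFin \o f] <= m%:E)%E <-> \forall x \ae mu, `|f x| <= m.
Proof.
rewrite Lnorm_yE; split.
  by move=> /ess_supP; apply: filterS => x /=; rewrite lee_fin.
by move=> h; apply/ess_supP; apply: filterS h => x /=; rewrite lee_fin.
Qed.

Lemma bounded_pairsP (Q : probability T R) (m : R) (u : hsum (L2 Q) (L2 Q)) :
  bounded_pairs Q m u <-> (\forall x \ae Q, `|L2_fun u.1 x| <= m) /\
                          (\forall x \ae Q, `|L2_fun u.2 x| <= m).
Proof.
rewrite /bounded_pairs /= ge_max; split.
  by move=> /andP[/Lnorm_y_leP h1 /Lnorm_y_leP h2].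
by move=> [h1 h2]; apply/andP; split; exact/Lnorm_y_leP.
Qed.

End essential_bounds.

(** Of the two factors dnu/dmu in the square, one changes the measure to nu and the other is
    bounded. *)
Lemma Lfun2_mul_density (d : measure_display) (T : measurableType d)
    (R : realType) (nu : {finite_measure set T -> \bar R})
    (mu : {finite_measure set T -> \bar R}) (K : R) (k : T -> R) :
  nu `<< mu -> (\forall x \ae mu, `|density nu mu x| <= K) ->
  k \in Lfun nu 2%:E -> (fun x => density nu mu x * k x) \in Lfun mu 2%:E.
Proof.
move=> numu dK /Lfun2P[mk k2]; have md := measurable_density numu.
apply/Lfun2P; split; first exact: measurable_funM.
have k2' := (Rintegrable_densityP numu (measurable_funX 2 mk)).2 k2.
have := Rintegrable_ae_bounded k2' md dK.
by apply: eq_integrable => // x _ /=; congr (_%:E); ring.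
Qed.

(** * Tangent space of the bounded pairs *)

Section tangent_space_of_bounded_pairs.
Context (d : measure_display) (T : measurableType d) (R : realType).
Variables (Q : probability T R) (m : R) (u : hsum (L2 Q) (L2 Q)).
Local Notation U := (bounded_pairs Q m).
Hypotheses (m0 : 0 < m) (Uu : U u).

Lemma bounded_pairs_convex (v : hsum (L2 Q) (L2 Q)) (e : R) : U v ->
  0 <= e <= 1 -> U (u + e *: (v - u)).
Proof.
move=> /bounded_pairsP[v1 v2] e01; have /bounded_pairsP[u1 u2] := Uu.
have conv (a b : R) : `|a| <= m -> `|b| <= m -> `|a + e * (b - a)| <= m.
  have /andP[e0 e1] := e01 => am bm.
  rewrite (_ : a + _ = (1 - e) * a + e * b); last by ring.
  apply: (le_trans (ler_normD _ _)); rewrite !normrM (ger0_norm e0).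
  rewrite ger0_norm ?subr_ge0//.
  rewrite [leRHS](_ : _ = (1 - e) * m + e * m); last by ring.
  by rewrite lerD// ler_wpM2l// subr_ge0.
apply/bounded_pairsP; split.
- by move: u1 v1; apply: filterS2 => x; exact: conv.
- by move: u2 v2; apply: filterS2 => x; exact: conv.
Qed.

(** U is convex, so the segment from u to v is a path in U; its remainder is exactly 0. *)
Lemma set_tangent_set_sub (v : hsum (L2 Q) (L2 Q)) : U v ->
  set_tangent_set U u (v - u).
Proof.
move=> Uv; exists (fun e => u + e *: (v - u)); split.
  by move=> e e01; exact: bounded_pairs_convex.
apply/littleo0P => eps eps0; near=> e.
rewrite (_ : _ - _ - _ = 0); last by rewrite [u + _]addrC addrK subrr.
by rewrite hnorm0 normr0 mulr_ge0// ltW.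
Unshelve. all: by end_near. Qed.

Lemma bounded_pairs0 : U 0.
Proof.
by apply/bounded_pairsP; split; apply: aeW => x; rewrite /L2_fun /= normr0 ltW.
Qed.

(* c v = c (v - u) - c (0 - u) with both v and 0 in U. *)
Lemma lin_span_scale (v : hsum (L2 Q) (L2 Q)) (c : R) : U v ->
  lin_span (set_tangent_set U u) (c *: v).
Proof.
move=> Uv.
exists 2%N, (fun i => if i == 0 then c else - c),
  (fun i => if i == 0 then v - u else 0 - u); split.
  by move=> i; case: ifP => _; apply: set_tangent_set_sub => //; exact: bounded_pairs0.
by rewrite !big_ord_recl big_ord0 /= addr0 sub0r scalerN scaleNr opprK -scalerDr subrK.
Qed.

Lemma L2_truncation (f : L2 Q) (eta : R) : 0 < eta -> exists K (g : L2 Q),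
  [/\ 0 < K, forall x, `|L2_fun g x| <= K & hdot (f - g) (f - g) <= eta].
Proof.
move=> eta0; have f2 := L2_Lfun2 f; have mf := measurable_L2_fun f.
have [K K0 tail] := Rintegral_tail_small (Lfun2_sqr f2) eta0.
set A := [set x | K <= _] in tail.
have mA : measurable A.
  have mS : measurable_fun setT (fun z => `|L2_fun f z ^+ 2|).
    by apply: measurableT_comp => //; exact: measurable_funX.
  have -> : A = (fun z => `|L2_fun f z ^+ 2|) @^-1` `[K, +oo[.
    by apply/seteqP; split => z /=; rewrite in_itv/= andbT.
  by rewrite -[_ @^-1` _]setTI; exact: mS.
pose g x := \1_(~` A) x * L2_fun f x.
(* Off A, f^2 < K < (K + 1)^2, which bounds |f| without a square root of K. *)
have gK x : `|g x| <= K + 1.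
  rewrite /g indicE; have [xA|xA] := boolP (x \in ~` A); last first.
    by rewrite mul0r normr0 addr_ge0// ltW.
  rewrite mul1r; move: xA; rewrite inE /A /= => /negP; rewrite -ltNge normrX => fK.
  rewrite leNgt; apply/negP => lt1.
  have : (K + 1) ^+ 2 < `|L2_fun f x| ^+ 2.
    by rewrite ltr_pXn2r// nnegrE// addr_ge0// ltW.
  move=> /lt_trans/(_ fK); rewrite sqrrD expr1n mulr1; have := sqr_ge0 K.
  by move: K0; move: (K) => k; lra.
have mg : measurable_fun setT g.
  by apply: measurable_funM => //; apply: measurable_indic; exact: measurableC.
have g2 : g \in Lfun Q 2%:E := ae_bounded_Lfun2 mg (aeW _ gK).
exists (K + 1), (Lfun_Sub (lee1n 2) g2 : L2 Q); split => //.
  by rewrite ltr_wpDr.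
rewrite L2_dot_sqr (le_trans _ tail)// [leRHS]Rintegral_mul_indic le_eqVlt.
apply/orP; left; apply/eqP; apply: eq_Rintegral => x _.
transitivity ((L2_fun f x - g x) ^+ 2) => //; rewrite /g !indicE in_setC.
by case: (x \in A) => /=;
  rewrite ?mul0r ?mul1r ?subr0 ?subrr ?expr0n// ger0_norm// sqr_ge0.
Qed.

(** Bounded pairs are dense in L^2(Q) + L^2(Q), and each is a multiple of a pair in U. *)
Lemma set_tangent_space_bounded_pairs (v : hsum (L2 Q) (L2 Q)) :
  set_tangent_space U u v.
Proof.
move=> e e0; have ee0 : 0 < e ^+ 2 / 4 by rewrite divr_gt0// exprn_gt0.
have [K1 [g1 [K10 g1K g1e]]] := L2_truncation v.1 ee0.
have [K2 [g2 [K20 g2K g2e]]] := L2_truncation v.2 ee0.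
pose K := K1 + K2; have K0 : 0 < K by rewrite addr_gt0.
(* Dividing by c brings the bound K down to m; this is where m > 0 enters. *)
pose c := K / m; have c0 : 0 < c by rewrite divr_gt0.
pose g : hsum (L2 Q) (L2 Q) := (g1, g2).
exists (c *: (c^-1 *: g)); last first.
  rewrite scalerA mulfV ?gt_eqF// scale1r /hnorm.
  rewrite -[ltRHS](ger0_norm (ltW e0)) -sqrtr_sqr ltr_sqrt ?exprn_gt0//.
  rewrite hsum_dotE; apply: (le_lt_trans (lerD g1e g2e)).
  by move: ee0; move: (e ^+ 2) => t; lra.
apply: lin_span_scale; apply/bounded_pairsP.
have cK (a b : R) : `|a| <= b -> b <= K -> `|c^-1 * a| <= m.
  move=> ab bK; rewrite normrM gtr0_norm ?invr_gt0// /c invf_div.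
  by rewrite mulrAC ler_pdivrMr// ler_wpM2l ?(ltW m0)// (le_trans ab).
have K1K : K1 <= K by rewrite /K lerDl ltW.
have K2K : K2 <= K by rewrite /K lerDr ltW.
split; apply: aeW => x.
- by rewrite [L2_fun _ x](L2_funZ c^-1 g1); exact: cK (g1K x) K1K.
- by rewrite [L2_fun _ x](L2_funZ c^-1 g2); exact: cK (g2K x) K2K.
Qed.

End tangent_space_of_bounded_pairs.

(** * Derivative and adjoint *)

Section derivative_and_adjoint.
Context (R : realType) (dZ dX : measure_display)
  (Z : measurableType dZ) (X : measurableType dX).
Variables (C : {mfun Z >-> X}) (M : set (probability Z R))
  (Q P : probability Z R) (m : R) (u : hsum (L2 Q) (L2 Q)).
Local Notation U := (bounded_pairs Q m).
Local Notation QX := (distribution Q C).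
Local Notation PX := (distribution P C).
Local Notation E := (cond_expectation P C).
Hypotheses (equivM : forall P1 P2, M P1 -> M P2 -> P1 `<< P2)
  (MQ : M Q) (MP : M P) (Uu : U u).
Variables K1 K2 : R.
Hypotheses (K10 : 0 <= K1) (K20 : 0 <= K2)
  (dQX : \forall x \ae PX, `|density QX PX x| <= K1)
  (dPQ : \forall z \ae Q, `|density P Q z| <= K2).

(** The expansion asks for a bound that is at least 1. *)
Let m' := Num.max m 1.
Let m'1 : 1 <= m'. Proof. by rewrite /m' le_max lexx orbT. Qed.

Let PQ : P `<< Q. Proof. exact: equivM. Qed.
Let QXPX : QX `<< PX. Proof. exact/null_dominates_distribution/equivM. Qed.
Let PXQX : PX `<< QX. Proof. exact/null_dominates_distribution/equivM. Qed.

Let bounded1 P' (v : hsum (L2 Q) (L2 Q)) : M P' -> U v ->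
  \forall z \ae P', `|L2_fun v.1 z| <= m'.
Proof.
move=> MP' /bounded_pairsP[v1 _]; have P'Q := equivM MP' MQ.
apply: filterS (ae_dominates P'Q v1) => z h.
by rewrite (le_trans h)// /m' le_max lexx.
Qed.

Let bounded2 P' (v : hsum (L2 Q) (L2 Q)) : M P' -> U v ->
  \forall z \ae P', `|L2_fun v.2 z| <= m'.
Proof.
move=> MP' /bounded_pairsP[_ v2]; have P'Q := equivM MP' MQ.
apply: filterS (ae_dominates P'Q v2) => z h.
by rewrite (le_trans h)// /m' le_max lexx.
Qed.

(** The covariance of bounded functions is bounded, hence in L^2(Q_X), so [theta] is not the default
    value. *)
Lemma theta_ae P' v : M P' -> U v ->
  \forall x \ae QX, L2_fun (theta C Q P' v) x =
    cond_covariance P' C (L2_fun v.1) (L2_fun v.2) x.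
Proof.
move=> MP' Uv; apply: L2_class_fun.
have [b1 b2] := (bounded1 MP' Uv, bounded2 MP' Uv).
have i1 := ae_bounded_integrable (measurable_L2_fun v.1) b1.
have i2 := ae_bounded_integrable (measurable_L2_fun v.2) b2.
have QXP'X : QX `<< distribution P' C by exact/null_dominates_distribution/equivM.
have bd : \forall x \ae QX,
    `|cond_covariance P' C (L2_fun v.1) (L2_fun v.2) x| <= (2 * m') ^+ 2.
  exact: (ae_dominates QXP'X (cond_covariance_bounded C i1 i2 b1 b2)).
apply: ae_bounded_Lfun2 bd.
exact: measurable_cond_covariance (measurable_L2_fun _) (measurable_L2_fun _) b1 b2.
Qed.

Let f := L2_fun u.1.
Let h := L2_fun u.2.
Let mf : measurable_fun setT f. Proof. exact: measurable_L2_fun. Qed.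
Let mh : measurable_fun setT h. Proof. exact: measurable_L2_fun. Qed.
Let fm : \forall z \ae P, `|f z| <= m'. Proof. exact: bounded1. Qed.
Let hm : \forall z \ae P, `|h z| <= m'. Proof. exact: bounded2. Qed.
Let fi : P.-Rintegrable f. Proof. exact: ae_bounded_integrable fm. Qed.
Let hi : P.-Rintegrable h. Proof. exact: ae_bounded_integrable hm. Qed.
Local Notation g1 := (centered P C f).
Local Notation g2 := (centered P C h).
Local Notation N := (cov_residual P C f h).
Let mg1 : measurable_fun setT g1. Proof. exact: measurable_centered. Qed.
Let mg2 : measurable_fun setT g2. Proof. exact: measurable_centered. Qed.
Let g1b : \forall z \ae P, `|g1 z| <= 2 * m'. Proof. exact: centered_bounded. Qed.
Let g2b : \forall z \ae P, `|g2 z| <= 2 * m'. Proof. exact: centered_bounded. Qed.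
Let mN : measurable_fun setT N. Proof. exact: measurable_cov_residual mf mh fm hm. Qed.
Let Nb : \forall z \ae P, `|N z| <= 2 * (2 * m') ^+ 2.
Proof. exact: cov_residual_bounded. Qed.

Local Notation H := (hsum (L2 P) (hsum (L2 Q) (L2 Q))).

Let kfun (x : H) : Z -> R :=
  cov_derivative P C f h (L2_fun x.1) (L2_fun x.2.1) (L2_fun x.2.2).

(** The formula makes sense in every direction and not just in tangent ones: the bounds on the
    densities place t1, t2 in L^2(P) and the conditional expectation in L^2(Q_X). *)
Definition dtheta (x : H) : L2 QX := L2_class QX (E (kfun x)).

Let Lfun2_QP (t : L2 Q) : L2_fun t \in Lfun P 2%:E.
Proof. exact: (Lfun2_bounded_density PQ dPQ (L2_Lfun2 t)). Qed.

Let kfun2 x : kfun x \in Lfun P 2%:E.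
Proof.
exact: (Lfun2_cov_derivative C mf mh fm hm (L2_Lfun2 x.1) (Lfun2_QP _) (Lfun2_QP _)).
Qed.

Let Ek2 x : E (kfun x) \in Lfun PX 2%:E.
Proof. exact: Lfun2_cond_expectation. Qed.

Let Ek2' x : E (kfun x) \in Lfun QX 2%:E.
Proof. exact: (Lfun2_bounded_density QXPX dQX (Ek2 x)). Qed.

Lemma dtheta_ae x : \forall z \ae QX, L2_fun (dtheta x) z = E (kfun x) z.
Proof. exact: L2_class_fun. Qed.

Lemma dtheta_linear_comb a x y :
  \forall z \ae QX, L2_fun (dtheta (a *: x + y)) z =
    a * L2_fun (dtheta x) z + L2_fun (dtheta y) z.
Proof.
have [xi yi] := (Lfun2_integrable (kfun2 x), Lfun2_integrable (kfun2 y)).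
have key : \forall z \ae PX, E (kfun (a *: x + y)) z = a * E (kfun x) z + E (kfun y) z.
  move: (cond_expectationD C (RintegrableZ a xi) yi) (cond_expectationZ C a xi).
  apply: filterS2 => z + <- => <-; congr (E _ z); apply/funext => w.
  rewrite /kfun /cov_derivative !L2_funD !L2_funZ.
  move: (N w) (g1 w) (g2 w) (L2_fun x.1 w) (L2_fun x.2.1 w) (L2_fun x.2.2 w).
  move: (L2_fun y.1 w) (L2_fun y.2.1 w) (L2_fun y.2.2 w) => *; ring.
have {}key : \forall z \ae QX,
  E (kfun (a *: x + y)) z = a * E (kfun x) z + E (kfun y) z by exact: (ae_dominates QXPX key).
have xy : \forall z \ae QX, L2_fun (dtheta x) z = E (kfun x) z /\
    L2_fun (dtheta y) z = E (kfun y) z.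
  by move: (dtheta_ae x) (dtheta_ae y); apply: filterS2.
move: (dtheta_ae (a *: x + y)) key xy; apply: filterS3 => z h1 h2 [h3 h4].
exact: (etrans h1 (etrans h2 (f_equal2 (fun v w => a * v + w) (esym h3) (esym h4)))).
Qed.

Lemma dtheta_linear_on V : linear_on V dtheta.
Proof.
move=> a x y _ _; apply: L2_hnorm_ae0.
move: (dtheta_linear_comb a x y); apply: filterS => z hz.
by rewrite L2_funB hz L2_funD L2_funZ subrr.
Qed.

(** The squared norm costs K1 from Q_X to P_X, nothing by Jensen's inequality from P_X to P, 3 B^2
    for the pointwise bound, and at most 1 + K2 from P to Q. The added 1 makes L positive. *)
Lemma dtheta_bounded : exists2 L, 0 < L &
  forall x, hdot (dtheta x) (dtheta x) <= L * hdot x x.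
Proof.
pose B := 9 * (2 * m') ^+ 2.
have B0 : 0 <= B by rewrite mulr_ge0// sqr_ge0.
pose c := K1 * (3 * B ^+ 2).
have c0 : 0 <= c.
  by apply: mulr_ge0 => //; apply: mulr_ge0 => //; exact: sqr_ge0.
exists (c * (1 + K2) + 1); first by rewrite ltr_wpDl// mulr_ge0// addr_ge0.
move=> x; rewrite (L2_dot_ae_sqr _ (dtheta_ae x)); last first.
  exact: Lfun2_measurable (Ek2 x).
apply: (le_trans (le_Rintegral_bounded_density QXPX dQX (Lfun2_sqr (Ek2 x)) _)).
  by move=> z; exact: sqr_ge0.
apply: (le_trans (ler_wpM2l K10 (le_Rintegral_cond_expectation_sqr C (kfun2 x)))).
have m21 : 1 <= 2 * m' by rewrite (le_trans m'1)// ler_peMl ?ler1n// (le_trans _ m'1).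
have s2 := Lfun2_sqr (L2_Lfun2 x.1).
have t12 := Lfun2_sqr (Lfun2_QP x.2.1).
have t22 := Lfun2_sqr (Lfun2_QP x.2.2).
have t12' := Lfun2_sqr (L2_Lfun2 x.2.1).
have t22' := Lfun2_sqr (L2_Lfun2 x.2.2).
have kle : \forall z \ae P, kfun x z ^+ 2 <= 3 * B ^+ 2 *
    (L2_fun x.1 z ^+ 2 + L2_fun x.2.1 z ^+ 2 + L2_fun x.2.2 z ^+ 2).
  move: g1b g2b (ae_distribution (cond_covariance_bounded C fi hi fm hm)).
  apply: filterS3 => z c1 c2 c3.
  (* With a = s / 2 the linear part of the covariance is the derivative integrand. *)
  have := cov_linear_bound (L2_fun x.1 z / 2) (L2_fun x.2.1 z) (L2_fun x.2.2 z)
    m21 c1 c2 c3.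
  rewrite -/B (mulrC 2) mulfVK// /kfun /cov_derivative /cov_residual.
  move: (g1 z) (g2 z) (cond_covariance _ _ _ _ _) => v1 v2 cv.
  move: (L2_fun x.1 z) (L2_fun x.2.1 z) (L2_fun x.2.2 z) => s t1 t2.
  rewrite -addrA => kB; rewrite -real_normK ?num_real//.
  have Br := le_trans (normr_ge0 _) kB.
  apply: (@le_trans _ _ ((B * (`|s / 2| + `|t1| + `|t2|)) ^+ 2)).
    by rewrite lerXn2r// nnegrE.
  rewrite exprMn (mulrC 3) -[leRHS]mulrA; apply: ler_wpM2l; first exact: sqr_ge0.
  rewrite normrM (ger0_norm (_ : 0 <= 2^-1))//.
  rewrite -(real_normK (num_real s)) -(real_normK (num_real t1)) -(real_normK (num_real t2)).
  have := normr_ge0 s; have := normr_ge0 t1; have := normr_ge0 t2.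
  move: `|s| `|t1| `|t2| => a b c' c'0 b0 a0.
  rewrite -subr_ge0 (_ : _ - _ = (a / 2 - b) ^+ 2 + (a / 2 - c') ^+ 2 +
    (b - c') ^+ 2 + 9 / 4 * a ^+ 2); last by field.
  by rewrite !addr_ge0 ?sqr_ge0// mulr_ge0 ?sqr_ge0// divr_ge0.
have i3 := RintegrableD (RintegrableD s2 t12) t22.
have := ae_le_Rintegral (Lfun2_sqr (kfun2 x)) (RintegrableZ (3 * B ^+ 2) i3) kle.
rewrite RintegralZl// RintegralD//; last exact: RintegrableD.
rewrite RintegralD// => le1.
have le2 := le_Rintegral_bounded_density PQ dPQ t12' (fun z => sqr_ge0 _).
have le3 := le_Rintegral_bounded_density PQ dPQ t22' (fun z => sqr_ge0 _).
rewrite !hsum_dotE !L2_dot_sqr.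
have a0 : 0 <= \int[P]_z (L2_fun x.1 z ^+ 2).
  by apply: Rintegral_ge0 => z _; exact: sqr_ge0.
have b0 : 0 <= \int[Q]_z (L2_fun x.2.1 z ^+ 2).
  by apply: Rintegral_ge0 => z _; exact: sqr_ge0.
have d0 : 0 <= \int[Q]_z (L2_fun x.2.2 z ^+ 2).
  by apply: Rintegral_ge0 => z _; exact: sqr_ge0.
apply: (le_trans (ler_wpM2l K10 le1)); rewrite mulrA -/c.
move: (\int[P]_z (L2_fun x.1 z ^+ 2)) (\int[P]_z (L2_fun x.2.1 z ^+ 2))
  (\int[P]_z (L2_fun x.2.2 z ^+ 2)) (\int[Q]_z (L2_fun x.2.1 z ^+ 2))
  (\int[Q]_z (L2_fun x.2.2 z ^+ 2)) a0 b0 d0 le2 le3 => p1 p2 p3 p4 p5 a0 b0 d0 le2 le3.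
move: c c0 => c c0.
have h1 : c * (p1 + p2 + p3) <= c * ((1 + K2) * (p1 + (p4 + p5))).
  apply: ler_wpM2l => //.
  rewrite (_ : (1 + K2) * _ = (p1 + K2 * p4 + K2 * p5) + (K2 * p1 + p4 + p5)).
    by rewrite -[leLHS]addr0 lerD// ?lerD// !addr_ge0// mulr_ge0.
  by ring.
apply: (le_trans h1); rewrite mulrA [leRHS]mulrDl mul1r lerDl.
by rewrite !addr_ge0.
Qed.

Lemma dtheta_continuous_on V : continuous_on V dtheta.
Proof.
have [L L0 bd] := dtheta_bounded => x _ e e0.
have sL0 : 0 < Num.sqrt L by rewrite sqrtr_gt0.
exists (e / Num.sqrt L); first by rewrite divr_gt0.
move=> y _ yx; have -> : hnorm (dtheta y - dtheta x) = hnorm (dtheta (y - x)).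
  rewrite /hnorm; congr Num.sqrt; apply: L2_dot_ae_sqr_eq.
  have := dtheta_linear_comb (-1) x y; rewrite scaleN1r (addrC (- x)).
  by apply: filterS => z ->; rewrite L2_funB mulN1r addrC.
rewrite ltr_pdivlMr// in yx; apply: le_lt_trans yx.
rewrite /hnorm -sqrtrM; last exact: hdot_ge0.
by rewrite ler_wsqrtr// mulrC.
Qed.

Lemma dtheta_derivative s t P_ u_ : model_path M s P_ -> set_path U u t u_ ->
  Defs.littleo0
    (fun e => hnorm (theta C Q (P_ e) (u_ e) - theta C Q P u - e *: dtheta (s, t)))
    (fun e => e).
Proof.
move=> [MP_ P_0 qmd] [Uu_ uo].
pose B := 9 * (2 * m') ^+ 2.
have B0 : 0 <= B by rewrite mulr_ge0// sqr_ge0.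
pose fe e := L2_fun (u_ e).1.
pose he e := L2_fun (u_ e).2.
pose W e := \int[P]_z (remainder_size P f h (P_ e) (fe e) (he e)
  (L2_fun s) (L2_fun t.1) (L2_fun t.2) e z ^+ 2).
pose S2 z := direction_size (L2_fun s) (L2_fun t.1) (L2_fun t.2) z ^+ 2.
pose T K := \int[P]_(z in [set z | K <= `|S2 z|]) `|S2 z|.
have S2i : P.-Rintegrable S2.
  apply: Lfun2_sqr; apply: Lfun2_direction_size => //.
  exact: L2_Lfun2.
pose c1 := K1 * (2 * (41 * B ^+ 2) ^+ 2).
pose c2 := K1 * (2 * B ^+ 2).
apply: (@littleo0_sqrt_bound R _ W T c1 c2 (\int[P]_z S2 z)).
- by apply: mulr_ge0 => //; apply: mulr_ge0 => //; exact: sqr_ge0.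
- by apply: mulr_ge0 => //; apply: mulr_ge0 => //; exact: sqr_ge0.
- by apply: Rintegral_ge0 => z _; exact: sqr_ge0.
- by move=> eta eta0; exact: Rintegral_tail_small.
- move=> eta eta0.
  have k0 : 0 < 3 * (1 + K2) by rewrite mulr_gt0// ltr_wpDr.
  (* W <= 3 (eta' + K2 eta') e^2: 3 from the square of a sum of three terms, K2 from bounding
     integrals under P by integrals under Q. *)
  pose eta' := eta / (3 * (1 + K2)).
  have eta'0 : 0 < eta' by rewrite divr_gt0.
  have seta0 : 0 < Num.sqrt eta' by rewrite sqrtr_gt0.
  have hq := (littleo0P _ _).1 qmd _ eta'0.
  (* The remainder of the path in U is an unsquared norm, unlike the quadratic mean remainder; hence
     the square root of eta'. *)
  have hu := (littleo0P _ _).1 uo _ seta0.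
  near=> e.
  have e0 : 0 < e by near: e; exact: nbhs_right_gt.
  have e1 : e <= 1 by near: e; apply: nbhs_right_le.
  have e01 : 0 <= e <= 1 by rewrite ltW.
  have MPe := MP_ e e01; have Uue := Uu_ e e01.
  have PeP := equivM MPe MP.
  have [b1 b2] := (bounded1 MP Uue, bounded2 MP Uue).
  have R2 := Lfun2_score_remainder PeP e (L2_Lfun2 s).
  have qe : qmd_remainder (P_ e) s e <= eta' * e ^+ 2.
    have : `|qmd_remainder (P_ e) s e| <= eta' * `|e ^+ 2| by near: e.
    by rewrite (ger0_norm (sqr_ge0 e)); apply: le_trans; exact: ler_norm.
  rewrite qmd_remainderE// in qe; last exact: (Lfun2_sqr R2).
  have ue : hdot (u_ e - u - e *: t) (u_ e - u - e *: t) <= eta' * e ^+ 2.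
    have : `|hnorm (u_ e - u - e *: t)| <= Num.sqrt eta' * `|e| by near: e.
    rewrite ger0_norm ?sqrtr_ge0// (ger0_norm (ltW e0)) => hle.
    rewrite -(sqr_sqrtr (hdot_ge0 _)) -(sqr_sqrtr (ltW eta'0)) -exprMn.
    by rewrite lerXn2r// nnegrE ?sqrtr_ge0// mulr_ge0 ?sqrtr_ge0// ltW.
  rewrite hsum_dotE hsum_fst hsum_snd in ue.
  set r1 : L2 Q := (u_ e).1 - u.1 - e *: t.1 in ue.
  set r2 : L2 Q := (u_ e).2 - u.2 - e *: t.2 in ue.
  have r1E z : L2_fun r1 z = fe e z - f z - e * L2_fun t.1 z.
    by rewrite /r1 !L2_funB L2_funZ.
  have r2E z : L2_fun r2 z = he e z - h z - e * L2_fun t.2 z.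
    by rewrite /r2 !L2_funB L2_funZ.
  clearbody r1 r2; rewrite !L2_dot_sqr in ue.
  have r1i := Lfun2_sqr (L2_Lfun2 r1).
  have r2i := Lfun2_sqr (L2_Lfun2 r2).
  have r1i' := Rintegrable_bounded_density PQ dPQ r1i.
  have r2i' := Rintegrable_bounded_density PQ dPQ r2i.
  have le1 := le_Rintegral_bounded_density PQ dPQ r1i (fun z => sqr_ge0 _).
  have le2 := le_Rintegral_bounded_density PQ dPQ r2i (fun z => sqr_ge0 _).
  have Ri := Lfun2_sqr R2.
  have Wi := RintegrableZ 3 (RintegrableD (RintegrableD Ri r1i') r2i').
  have rem2 : remainder_size P f h (P_ e) (fe e) (he e)
      (L2_fun s) (L2_fun t.1) (L2_fun t.2) e \in Lfun P 2%:E.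
    exact: (Lfun2_remainder_size mf mh fm hm PeP (measurable_L2_fun _)
      (measurable_L2_fun _) b1 b2 e (L2_Lfun2 s) (Lfun2_QP _) (Lfun2_QP _)).
  have sq3 (a b c : R) : (`|a| + `|b| + `|c|) ^+ 2 <= 3 * (a ^+ 2 + b ^+ 2 + c ^+ 2).
    rewrite -(real_normK (num_real a)) -(real_normK (num_real b)).
    rewrite -(real_normK (num_real c)) -subr_ge0.
    move: `|a| `|b| `|c| => x y z.
    rewrite (_ : _ - _ = (x - y) ^+ 2 + (x - z) ^+ 2 + (y - z) ^+ 2); last by ring.
    by rewrite !addr_ge0// sqr_ge0.
  have remle z : remainder_size P f h (P_ e) (fe e) (he e) (L2_fun s)
      (L2_fun t.1) (L2_fun t.2) e z ^+ 2 <=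
      3 * (score_remainder P (P_ e) (L2_fun s) e z ^+ 2 + L2_fun r1 z ^+ 2 +
           L2_fun r2 z ^+ 2).
    by rewrite r1E r2E; exact: sq3.
  have Wle := ae_le_Rintegral (Lfun2_sqr rem2) Wi (aeW _ remle).
  rewrite RintegralZl// in Wle; last exact/RintegrableD/r2i'/RintegrableD.
  rewrite RintegralD// in Wle; last exact: RintegrableD.
  rewrite RintegralD// in Wle.
  apply: (le_trans Wle).
  have i10 : 0 <= \int[Q]_z (L2_fun r1 z ^+ 2).
    by apply: Rintegral_ge0 => z _; exact: sqr_ge0.
  have i20 : 0 <= \int[Q]_z (L2_fun r2 z ^+ 2).
    by apply: Rintegral_ge0 => z _; exact: sqr_ge0.
  have -> : eta * e ^+ 2 = 3 * (eta' * e ^+ 2 + K2 * (eta' * e ^+ 2)).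
    have k0' : 3 * (1 + K2) != 0 by rewrite gt_eqF.
    by rewrite -[in LHS](divfK k0' eta) -/eta'; ring.
  rewrite ler_wpM2l// -addrA lerD//.
  apply: (le_trans (lerD le1 le2)); rewrite -mulrDr; exact: ler_wpM2l.
- near=> e.
  have e0 : 0 < e by near: e; exact: nbhs_right_gt.
  have e1 : e <= 1 by near: e; apply: nbhs_right_le.
  have e01 : 0 <= e <= 1 by rewrite ltW.
  have MPe := MP_ e e01; have Uue := Uu_ e e01.
  have [PeP PPe] := (equivM MPe MP, equivM MP MPe).
  have [b1 b2] := (bounded1 MP Uue, bounded2 MP Uue).
  split; first by apply: Rintegral_ge0 => z _; exact: sqr_ge0.
  move=> K K0.
  have err2 := Lfun2_cov_error C mf mh fm hm PeP PPe (measurable_L2_fun (u_ e).1)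
    (measurable_L2_fun (u_ e).2) b1 b2 e (L2_Lfun2 s) (Lfun2_QP t.1) (Lfun2_QP t.2).
  have bnd := cov_error_bound C m'1 mf mh fm hm PeP PPe (measurable_L2_fun (u_ e).1)
    (measurable_L2_fun (u_ e).2) b1 b2 (L2_Lfun2 s) (Lfun2_QP t.1) (Lfun2_QP t.2)
    (ltW e0) K0.
  have ae3 : \forall x \ae QX,
    L2_fun (theta C Q (P_ e) (u_ e) - theta C Q P u - e *: dtheta (s, t)) x =
    cond_covariance (P_ e) C (fe e) (he e) x - cond_covariance P C f h x -
      e * E (kfun (s, t)) x.
    move: (theta_ae MPe Uue) (theta_ae MP Uu) (dtheta_ae (s, t)).
    apply: filterS3 => x hx1 hx2 hx3; rewrite !L2_funB L2_funZ.
    by congr (_ - _ - e * _); [exact: hx1|exact: hx2|exact: hx3].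
  (* The error is measured in L^2(Q_X) but estimated in L^2(P_X); the bound K1 on the density joins
     the two. *)
  rewrite (L2_dot_ae_sqr _ ae3); last exact: Lfun2_measurable err2.
  apply: (le_trans (le_Rintegral_bounded_density QXPX dQX (Lfun2_sqr err2) _)).
    by move=> z; exact: sqr_ge0.
  apply: (le_trans (ler_wpM2l K10 bnd)).
  by rewrite /c1 /c2 mulrDr !mulrA.
Unshelve. all: by end_near. Qed.

(** * The adjoint *)

Let dw (w : L2 QX) x := density QX PX x * L2_fun w x.

Let dw2 w : dw w \in Lfun PX 2%:E.
Proof. exact: (Lfun2_mul_density QXPX dQX (L2_Lfun2 w)). Qed.

Let dwC2 w : (fun z => dw w (C z)) \in Lfun P 2%:E.
Proof. exact: Lfun2_distribution. Qed.

Let adj1 w z := dw w (C z) * N z.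
(** The indices cross: perturbing the first function pairs with the centred second one. The factor
    dP/dQ turns a pairing under P into one in L^2(Q). *)
Let adj21 w z := density P Q z * (dw w (C z) * g2 z).
Let adj22 w z := density P Q z * (dw w (C z) * g1 z).

Let adj1_2 w : adj1 w \in Lfun P 2%:E.
Proof. exact: (Lfun2_ae_bounded (dwC2 w) mN Nb). Qed.

Let dwg2_2 w : (fun z => dw w (C z) * g2 z) \in Lfun P 2%:E.
Proof. exact: (Lfun2_ae_bounded (dwC2 w) mg2 g2b). Qed.

Let dwg1_2 w : (fun z => dw w (C z) * g1 z) \in Lfun P 2%:E.
Proof. exact: (Lfun2_ae_bounded (dwC2 w) mg1 g1b). Qed.

Let adj21_2 w : adj21 w \in Lfun Q 2%:E.
Proof. exact: (Lfun2_mul_density PQ dPQ (dwg2_2 w)). Qed.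

Let adj22_2 w : adj22 w \in Lfun Q 2%:E.
Proof. exact: (Lfun2_mul_density PQ dPQ (dwg1_2 w)). Qed.

Definition dtheta_adjoint (w : L2 QX) : H :=
  (L2_class P (adj1 w), (L2_class Q (adj21 w), L2_class Q (adj22 w))).

(** The weight [dw] turns the pairing under Q_X into one under P_X, the tower property brings it to
    P, and the integrand splits along the three components of x; dP/dQ moves the last two to Q. The
    identity holds for every x, tangent or not. *)
Lemma hdot_dtheta x w : hdot (dtheta x) w = hdot x (dtheta_adjoint w).
Proof.
pose t1 := L2_fun x.2.1; pose t2 := L2_fun x.2.2; pose s := L2_fun x.1.
have kw := Lfun2_mul (Ek2' x) (L2_Lfun2 w).
have s1 := Lfun2_mul (L2_Lfun2 x.1) (adj1_2 w).
have t1i := Lfun2_mul (Lfun2_QP x.2.1) (dwg2_2 w).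
have t2i := Lfun2_mul (Lfun2_QP x.2.2) (dwg1_2 w).
transitivity (\int[P]_z (s z * adj1 w z) +
  (\int[P]_z (t1 z * (dw w (C z) * g2 z)) + \int[P]_z (t2 z * (dw w (C z) * g1 z)))).
  have dki := Lfun2_mul (dwC2 w) (kfun2 x).
  have mdw := Lfun2_measurable (dw2 w).
  transitivity (\int[QX]_y (E (kfun x) y * L2_fun w y)).
    rewrite L2_dotE; apply: ae_eq_Rintegral.
    - by apply: measurable_funM; exact: measurable_L2_fun.
    - exact: Rintegrable_measurable kw.
    - by move: (dtheta_ae x); apply: filterS => y ->.
  rewrite -(Rintegral_density QXPX kw).
  transitivity (\int[PX]_y (dw w y * E (kfun x) y)).
    by apply: eq_Rintegral => y _; rewrite /dw; ring.
  have [_ ->] := tower (Lfun2_integrable (kfun2 x)) mdw dki.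
  have e1 := RintegralD measurableT t1i t2i.
  have e2 := RintegralD measurableT s1 (RintegrableD t1i t2i).
  apply: (eq_trans _ (f_equal (fun v => \int[P]_z (s z * adj1 w z) + v) e1)).
  apply: (eq_trans _ e2); apply: eq_Rintegral => z _; rewrite /kfun /cov_derivative /adj1.
  rewrite -/(s) -/(t1) -/(t2).
  by move: (dw w (C z)) (s z) (t1 z) (t2 z) (N z) (g1 z) (g2 z) => *; ring.
have swap (t : L2 Q) (k a : Z -> R) :
    P.-Rintegrable (fun z => L2_fun t z * k z) -> a \in Lfun Q 2%:E ->
    (forall z, a z = density P Q z * k z) ->
    \int[P]_z (L2_fun t z * k z) = hdot t (L2_class Q a).
  move=> ki a2 aE; rewrite -(Rintegral_density PQ ki) L2_dotE.
  transitivity (\int[Q]_z (L2_fun t z * a z)).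
    by apply: eq_Rintegral => z _; rewrite aE; ring.
  apply: ae_eq_Rintegral.
  - exact: Rintegrable_measurable (Lfun2_mul (L2_Lfun2 t) a2).
  - by apply: measurable_funM; exact: measurable_L2_fun.
  - by move: (L2_class_fun a2); apply: filterS => z ->.
rewrite !hsum_dotE; congr (_ + (_ + _)).
- rewrite L2_dotE; apply: ae_eq_Rintegral.
  + exact: Rintegrable_measurable s1.
  + by apply: measurable_funM; exact: measurable_L2_fun.
  + by move: (L2_class_fun (adj1_2 w)); apply: filterS => z ->.
- exact: (swap _ _ _ t1i (adj21_2 w)).
- exact: (swap _ _ _ t2i (adj22_2 w)).
Qed.

(** E N = 0, so the weight [dw] multiplies zero after the tower property. Mean zero is what local
    nonparametricity requires of a tangent direction. *)
Lemma dtheta_adjoint_mean0 w : \int[P]_z L2_fun (dtheta_adjoint w).1 z = 0.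
Proof.
have Ni : P.-Rintegrable N := ae_bounded_integrable mN Nb.
have dNi := Lfun2_integrable (adj1_2 w).
have [i e] := tower Ni (Lfun2_measurable (dw2 w)) dNi.
transitivity (\int[P]_z adj1 w z).
  apply: ae_eq_Rintegral; [exact: measurable_L2_fun|exact: Rintegrable_measurable dNi|].
  exact: L2_class_fun.
rewrite -[LHS]e; transitivity (\int[PX]_x (cst 0 x : R)); last first.
  by rewrite Rintegral_cst// mul0r.
apply: ae_eq_Rintegral => //; first exact: Rintegrable_measurable i.
move: (cond_expectation_cov_residual C mf mh fm hm).
by apply: filterS => x ->; rewrite mulr0.
Qed.

Lemma dtheta_adjoint_tangent w : set_tangent_space U u (dtheta_adjoint w).2.
Proof.
have [m0|m0] := ltP 0 m; first exact: set_tangent_space_bounded_pairs.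
(* When m <= 0, a centred function is bounded by 2 m <= 0, hence vanishes. *)
have zero (k : Z -> R) : P.-Rintegrable k -> (\forall z \ae Q, `|k z| <= m) ->
    \forall z \ae Q, centered P C k z = 0.
  move=> ki km; have QP : Q `<< P := equivM MQ MP.
  have : \forall z \ae P, centered P C k z = 0.
    apply: filterS (centered_bounded C ki (ae_dominates PQ km)) => z kz.
    apply/eqP; rewrite -normr_le0 (le_trans kz)//.
    by rewrite pmulr_rle0.
  exact: (ae_dominates QP).
have /bounded_pairsP[u1 u2] := Uu.
have z1 : \forall z \ae Q, adj21 w z = 0.
  by apply: filterS (zero h hi u2) => z hz; rewrite /adj21 hz !mulr0.
have z2 : \forall z \ae Q, adj22 w z = 0.
  by apply: filterS (zero f fi u1) => z hz; rewrite /adj22 hz !mulr0.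
move=> e e0; exists 0; first exact: lin_span0.
rewrite subr0 /hnorm hsum_dotE.
have dot0 (a : Z -> R) : a \in Lfun Q 2%:E -> (\forall z \ae Q, a z = 0) ->
    hdot (L2_class Q a) (L2_class Q a) = 0.
  move=> a2 a0; rewrite (@L2_dot_ae_sqr _ _ _ _ _ (cst 0))//.
    rewrite (_ : (fun _ => _) = cst 0); last by apply/funext => x; rewrite /= expr0n.
    by rewrite Rintegral_cst// mul0r.
  by move: (L2_class_fun a2) a0; apply: filterS2 => z ->.
have d0 := f_equal2 +%R (dot0 _ (adj21_2 w) z1) (dot0 _ (adj22_2 w) z2).
rewrite (_ : Num.sqrt _ = 0)//.
by apply: (eq_trans (f_equal Num.sqrt d0)); rewrite addr0 sqrtr0.
Qed.

Lemma dtheta_adjoint_ae w :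
  let r1 z := L2_fun u.1 z - E (L2_fun u.1) (C z) in
  let r2 z := L2_fun u.2 z - E (L2_fun u.2) (C z) in
  [/\ \forall z \ae P, L2_fun (dtheta_adjoint w).1 z =
        density QX PX (C z) * L2_fun w (C z) *
          (r1 z * r2 z - L2_fun (theta C Q P u) (C z)),
      \forall z \ae Q, L2_fun (dtheta_adjoint w).2.1 z =
        density P Q z * density QX PX (C z) * L2_fun w (C z) * r2 z &
      \forall z \ae Q, L2_fun (dtheta_adjoint w).2.2 z =
        density P Q z * density QX PX (C z) * L2_fun w (C z) * r1 z].
Proof.
split.
(* [theta] is determined Q_X-almost everywhere; the identity is moved to P_X and pulled back along C
   to P. *)
- move: (ae_distribution (ae_dominates PXQX (theta_ae MP Uu))).
  move: (L2_class_fun (adj1_2 w)); apply: filterS2 => z h1 h2.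
  by rewrite h2; exact: h1.
- move: (L2_class_fun (adj21_2 w)); apply: filterS => z h1.
  by apply: (etrans h1); rewrite /adj21 /dw !mulrA.
- move: (L2_class_fun (adj22_2 w)); apply: filterS => z h1.
  by apply: (etrans h1); rewrite /adj22 /dw !mulrA.
Qed.

End derivative_and_adjoint.

(** [L2_class] returns 0 on functions outside L^2; the first conjunct ensures that on the model and
    the bounded pairs [theta] really is the class of the conditional covariance. *)
Theorem lemmaS9 (R : realType) (dZ dX : measure_display)
    (Z : measurableType dZ) (X : measurableType dX) (C : {mfun Z >-> X})
    (M : set (probability Z R)) (Q P : probability Z R) (m : R)
    (u : hsum (L2 Q) (L2 Q)) :
  let U := bounded_pairs Q m in
  let QX := distribution Q C in
  let PX := distribution P C in
  (forall P1 P2, M P1 -> M P2 -> P1 `<< P2) ->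
  M Q -> M P -> U u ->
  locally_nonparametric M P ->
  ('N[PX]_+oo ['d (charge_of_finite_measure QX) '/d PX] < +oo)%E ->
  ('N[Q]_+oo ['d (charge_of_finite_measure P) '/d Q] < +oo)%E ->
  (forall P' u', M P' -> U u' ->
     theta C Q P' u' = cond_covariance P' C u'.1 u'.2 %[ae QX]) /\
  exists (dtheta : hsum (L2 P) (hsum (L2 Q) (L2 Q)) -> L2 QX)
         (adj : L2 QX -> hsum (L2 P) (hsum (L2 Q) (L2 Q))),
    [/\ total_pathwise_derivative M U (theta C Q) P u dtheta,
        hermitian_adjoint (total_tangent_space M U P u) dtheta adj &
        forall w : L2 QX,
          let r1 z := u.1 z - cond_expectation P C u.1 (C z) in
          let r2 z := u.2 z - cond_expectation P C u.2 (C z) in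
          [/\ (adj w).1 = (fun z => density QX PX (C z) * w (C z) *
                (r1 z * r2 z - theta C Q P u (C z))) %[ae P],
              (adj w).2.1 = (fun z => density P Q z * density QX PX (C z) *
                w (C z) * r2 z) %[ae Q] &
              (adj w).2.2 = (fun z => density P Q z * density QX PX (C z) *
                w (C z) * r1 z) %[ae Q]]].
Proof.
move=> U QX PX equivM MQ MP Uu lnp dQXP dPQ.
have QXPX : QX `<< PX by exact/null_dominates_distribution/equivM.
have [K1 K10 dK1] := Lnorm_y_density_bounded QXPX dQXP.
have [K2 K20 dK2] := Lnorm_y_density_bounded (equivM _ _ MP MQ) dPQ.
split.
  move=> P' u' MP' Uu'; have := theta_ae C equivM MQ MP' Uu'.
  by apply: filterS => x h _.
exists (dtheta C u), (dtheta_adjoint P u); split.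
- split.
  + exact: (dtheta_linear_on equivM MQ MP Uu dK1 dK2).
  + exact: (dtheta_continuous_on equivM MQ MP Uu K10 K20 dK1 dK2).
  + move=> s t P_ u_.
    exact: (dtheta_derivative equivM MQ MP Uu K10 K20 dK1 dK2).
- move=> w; split; last first.
    by move=> x _; exact: (hdot_dtheta equivM MQ MP Uu dK1 dK2).
  split; last exact: (dtheta_adjoint_tangent equivM MQ MP Uu dK1 dK2).
  (* Local nonparametricity reduces membership in the tangent space at P to having mean zero. *)
  rewrite lnp; exact: (dtheta_adjoint_mean0 equivM MQ MP Uu dK1).
- move=> w r1 r2; have [h1 h2 h3] := dtheta_adjoint_ae equivM MQ MP Uu dK1 dK2 w.
  split.
  + by apply: filterS h1 => z h _.
  + by apply: filterS h2 => z h _.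
  + by apply: filterS h3 => z h _.
Qed.
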